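(* Let $Z^*$ be the optimal value (infimum) of the program, in the variables $Q_i\in\mathbb{S}^{n_i}$ and $p_{ij}\in\mathbb{R}$ ($1\le i\le N$, $1\le j\le M$), $$Z^*=\min_{Q_i,p_{ij}}\ \sum_{i=1}^N\Big\{\mathrm{Tr}(T_iQ_i^{-1})+\sum_{j=1}^M\kappa_{ij}p_{ij}\Big\}$$ subject to $$Q_iA_i+A_i^TQ_i+Q_iW_iQ_i-\sum_{j=1}^Mp_{ij}C_{ij}^TV_{ij}^{-1}C_{ij}\preceq0,\qquad Q_i\succ0,\qquad i=1,\dots,N,$$ $$0\le p_{ij}\le1,\qquad \sum_{i=1}^Np_{ij}\le1\ (j=1,\dots,M),\qquad \sum_{j=1}^Mp_{ij}\le1\ (i=1,\dots,N).$$ Then for every admissible observation policy $\pi$, $$\limsup_{T\to\infty}\frac1T\int_0^T\sum_{i=1}^N\Big\{\mathrm{Tr}(T_i\Sigma_i(t))+\sum_{j=1}^M\kappa_{ij}\pi_{ij}(t)\Big\}dt\ \ge\ Z^*.$$ Moreover $Z^*$ is also the optimal value (infimum) of the semidefinite program $$\min_{R_i,Q_i,p_{ij}}\ \sum_{i=1}^N\Big\{\mathrm{Tr}(T_iR_i)+\sum_{j=1}^M\kappa_{ij}p_{ij}\Big\}$$ over $R_i,Q_i\in\mathbb{S}^{n_i}$ and $p_{ij}\in\mathbb{R}$, subject to $$\begin{bmatrix} R_i & I \\ I & Q_i \end{bmatrix}\succ0,\qquad \begin{bmatrix} Q_iA_i+A_i^TQ_i-\sum_{j=1}^Mp_{ij}C_{ij}^TV_{ij}^{-1}C_{ij}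 & Q_iW_i^{1/2} \\ W_i^{1/2}Q_i & -I \end{bmatrix}\preceq0,\qquad i=1,\dots,N,$$ and the same linear constraints on $(p_{ij})$.
   Context: $\mathbb{S}^n$ denotes the real symmetric $n\times n$ matrices; $\preceq,\succ$ refer to the usual (Loewner) order. There are $N$ systems with state dimensions $n_i$ and $M$ sensors. Data: real matrices $A_i\in\mathbb{R}^{n_i\times n_i}$, symmetric positive semidefinite $W_i$ and $T_i$, matrices $C_{ij}$, symmetric positive definite $V_{ij}$, real costs $\kappa_{ij}$, and initial covariances $\Sigma_{i,0}$. Standing assumptions: (1) each $\Sigma_{i,0}$ is positive definite; (2) for each $i$ there exist sensor indices $j_1,\dots,j_m\in\{1,\dots,M\}$ ($m$ depending on $i$) such that $(A_i,\tilde C_i)$ is detectable, where $\tilde C_i=[C_{ij_1}^T,\dots,C_{ij_m}^T]^T$; (3) for each $i$, $(A_i,W_i^{1/2})$ is controllable. An admissible observation policy $\pi$ is a family of (measurable) functions $\pi_{ij}:[0,\infty)\to\{0,1\}$ ($\pi_{ij}(t)=1$ meaning that system $i$ is observed by sensor $j$ at time $t$) such that for all $t\ge0$: $\sum_{i=1}^N\pi_{ij}(t)\le1$ for each $j$, and $\sum_{j=1}^M\pi_{ij}(t)\le1$ for each $i$. Under policy $\pi$, the error covariance $\Sigma_i(t)$ of the Kalman-Bucy filter for system $i$ is the solution of $$\dot\Sigma_i=A_i\Sigma_i+\Sigma_iA_i^T+W_i-\Sigma_i\Big(\sum_{j=1}^M\pi_{ij}(t)C_{ij}^TV_{ij}^{-1}C_{ij}\Big)\Sigma_i,\qquad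 \Sigma_i(0)=\Sigma_{i,0}.$$ *)

(* Defs.v *)
From HB Require Import structures.
From mathcomp Require Import all_boot all_order all_algebra.
From mathcomp Require Import sesquilinear.
From mathcomp Require Import complex.
From mathcomp Require Import all_classical all_reals all_analysis.

Set Implicit Arguments.
Unset Strict Implicit.
Unset Printing Implicit Defensive.

Import Order.TTheory GRing.Theory Num.Theory.
Import numFieldNormedType.Exports.

Local Open Scope classical_set_scope.
Local Open Scope ring_scope.

Definition psdmx (R : realType) (n : nat) (A : 'M[R]_n) : Prop :=
  A \is symmetricmx /\ forall x : 'cV[R]_n, 0 <= (x^T *m A *m x) 0 0.

Definition pdmx (R : realType) (n : nat) (A : 'M[R]_n) : Prop :=
  A \is symmetricmx /\
  forall x : 'cV[R]_n, x != 0 -> 0 < (x^T *m A *m x) 0 0.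

Definition loewner_le (R : realType) (n : nat) (A B : 'M[R]_n) : Prop :=
  psdmx (B - A).

Definition loewner_lt (R : realType) (n : nat) (A B : 'M[R]_n) : Prop :=
  pdmx (B - A).

Notation "A ⪯ B" := (loewner_le A B) (at level 70, no associativity).
Notation "A ≺ B" := (loewner_lt A B) (at level 70, no associativity).

(* The principal square root: a positive semidefinite W has exactly one
   positive semidefinite square root.  The default 0 is only reached when W is
   not positive semidefinite. *)
Definition sqrtmx (R : realType) (n : nat) (W : 'M[R]_n) : 'M[R]_n :=
  xget 0 [set S | psdmx S /\ S *m S = W].

Definition hurwitz (R : realType) (n : nat) (A : 'M[R]_n) : Prop :=
  forall z : R[i],
    eigenvalue (map_mx (real_complex R) A) z -> complex.Re z < 0.

Definition detectable (R : realType) (n q : nat)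
    (A : 'M[R]_n) (C : 'M[R]_(q, n)) : Prop :=
  exists L : 'M[R]_(n, q), hurwitz (A - L *m C).

(* X solves X' = F(t, X), X(0) = X0 on [0, +oo[ in the sense of Caratheodory,
   i.e. X is locally absolutely continuous and the equation holds for almost
   every t; this is stated in the equivalent integral form, entry by entry.
   (A right-hand side driven by a merely measurable input has no classical
   solution in general.) Only the values of X on [0, +oo[ matter. *)
Definition ode_solution (R : realType) (m n : nat)
    (F : R -> 'M[R]_(m, n) -> 'M[R]_(m, n)) (X0 : 'M[R]_(m, n))
    (X : R -> 'M[R]_(m, n)) : Prop :=
  forall t : R, 0 <= t -> forall (a : 'I_m) (b : 'I_n),
    (@lebesgue_measure R).-integrable `[0, t]
      (fun s => (F s (X s) a b)%:E) /\
    X t a b = X0 a b + \int[@lebesgue_measure R]_(s in `[0, t]) F s (X s) a b.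

(* Every state can be steered to every other one in finite time by a locally
   integrable input. *)
Definition controllable (R : realType) (n m : nat)
    (A : 'M[R]_n) (B : 'M[R]_(n, m)) : Prop :=
  forall x0 x1 : 'cV[R]_n,
  exists (tau : R) (u : R -> 'cV[R]_m) (x : R -> 'cV[R]_n),
    [/\ 0 < tau,
        forall (t : R) (k : 'I_m), 0 <= t ->
          (@lebesgue_measure R).-integrable `[0, t] (fun s => (u s k 0)%:E),
        ode_solution (fun t y => A *m y + B *m u t) x0 x
      & x tau = x1].

Definition info_mx (R : realType) (n q : nat)
    (C : 'M[R]_(q, n)) (V : 'M[R]_q) : 'M[R]_n :=
  C^T *m invmx V *m C.

Section ScheduleProblem.

Context (R : realType) (N M : nat) (n : 'I_N -> nat) (q : 'I_N -> 'I_M -> nat).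
Implicit Types (A W T : forall i : 'I_N, 'M[R]_(n i))
  (C : forall (i : 'I_N) (j : 'I_M), 'M[R]_(q i j, n i))
  (V : forall (i : 'I_N) (j : 'I_M), 'M[R]_(q i j))
  (kappa p : 'I_N -> 'I_M -> R) (pi : 'I_N -> 'I_M -> R -> bool).

(* The stacked output matrix of the sensors js 0, ..., js (m - 1), as seen by
   system i. *)
Definition stacked_output C (i : 'I_N) (m : nat) (js : 'I_m -> 'I_M) :
    'M[R]_(\sum_(k < m) q i (js k), n i) :=
  \mxcol_(k < m) C i (js k).

Definition admissible pi : Prop :=
  [/\ forall i j, measurable_fun (`[0, +oo[ : set (measurableTypeR R)) (pi i j),
      forall (t : R) j, 0 <= t -> (\sum_(i < N) pi i j t <= 1)%N
    & forall (t : R) i, 0 <= t -> (\sum_(j < M) pi i j t <= 1)%N].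

Definition kalman_bucy_rhs A W C V pi (i : 'I_N) (t : R) (S : 'M[R]_(n i)) :
    'M[R]_(n i) :=
  A i *m S + S *m (A i)^T + W i
  - S *m (\sum_(j < M) (pi i j t)%:R *: info_mx (C i j) (V i j)) *m S.

Definition error_covariance A W C V (Sigma0 : forall i, 'M[R]_(n i)) pi
    (Sigma : forall i, R -> 'M[R]_(n i)) : Prop :=
  forall i, ode_solution (kalman_bucy_rhs A W C V pi (i := i))
              (Sigma0 i) (Sigma i).

Definition average_cost T kappa pi (Sigma : forall i, R -> 'M[R]_(n i)) :
    \bar R :=
  limf_esup (fun tau : R =>
    (tau^-1)%:E * \int[@lebesgue_measure R]_(t in `[0%R, tau])
      (\sum_(i < N) (\tr (T i *m Sigma i t)
                     + \sum_(j < M) kappa i j * (pi i j t)%:R))%:E)%E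
    +oo%R.

Definition schedule_constraints p : Prop :=
  [/\ forall i j, 0 <= p i j <= 1,
      forall j, \sum_(i < N) p i j <= 1
    & forall i, \sum_(j < M) p i j <= 1].

Definition riccati_feasible A W C V (Q : forall i, 'M[R]_(n i)) p : Prop :=
  (forall i,
    [/\ Q i *m A i + (A i)^T *m Q i + Q i *m W i *m Q i
          - \sum_(j < M) p i j *: info_mx (C i j) (V i j) ⪯ 0
      & 0 ≺ Q i]) /\
  schedule_constraints p.

(* Optimal values are infima in the extended reals. *)
Definition riccati_value A W T C V kappa : \bar R :=
  ereal_inf [set z | exists (Q : forall i, 'M[R]_(n i)) p,
    riccati_feasible A W C V Q p /\
    z = (\sum_(i < N) (\tr (T i *m invmx (Q i))
                       + \sum_(j < M) kappa i j * p i j))%:E].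

Definition sdp_feasible A W C V (S Q : forall i, 'M[R]_(n i)) p : Prop :=
  (forall i,
    [/\ S i \is symmetricmx,
        Q i \is symmetricmx,
        0 ≺ block_mx (S i) 1%:M 1%:M (Q i)
      & block_mx
          (Q i *m A i + (A i)^T *m Q i
             - \sum_(j < M) p i j *: info_mx (C i j) (V i j))
          (Q i *m sqrtmx (W i))
          (sqrtmx (W i) *m Q i)
          (- 1%:M) ⪯ 0]) /\
  schedule_constraints p.

Definition sdp_value A W T C V kappa : \bar R :=
  ereal_inf [set z | exists (S Q : forall i, 'M[R]_(n i)) p,
    sdp_feasible A W C V S Q p /\
    z = (\sum_(i < N) (\tr (T i *m S i)
                       + \sum_(j < M) kappa i j * p i j))%:E].

End ScheduleProblem.

(* Main.v *)
(** Write [P = Sigma^-1].  Along a trajectory [P' = H - (P A + A^T P + P W P)], where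
    [H] is the active information matrix.  Hence the time average [Q] of [P] over
    [[0, tau]] satisfies, by convexity of [P |-> P W P],
      [Q A + A^T Q + Q W Q - avg H <= (P(0) - P(tau)) / tau <= P(0) / tau],
    while [tr (T Q^-1) <= avg tr (T Sigma)] by operator convexity of the inverse.  So
    [Q], with the observation frequencies for [p], violates the constraints by
    [O(1 / tau)] only.  Detectability yields a strictly feasible point (a small multiple
    of a Lyapunov matrix, all sensors used with equal frequency); mixing in a small
    proportion of it repairs feasibility, and by convexity the cost changes as little.

    The control is merely measurable, so instead of differentiating [Sigma^-1] one uses
    Euler steps with [O(h^2)] error, in which the control enters only through the
    accumulated observation times, and averages [P] over a fine grid.

    The semidefinite program is equivalent to the Riccati one by Schur complements. *)
Require Import Defs.
From HB Require Import structures.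
From mathcomp Require Import all_boot all_order all_algebra.
From mathcomp Require Import sesquilinear.
From mathcomp Require Import complex.
From mathcomp Require Import all_classical all_reals all_analysis.
From mathcomp Require Import ring lra.
Import Order.TTheory GRing.Theory Num.Theory.
Import numFieldNormedType.Exports.

Local Open Scope classical_set_scope.
Local Open Scope ring_scope.

Set Implicit Arguments.
Unset Strict Implicit.
Unset Printing Implicit Defensive.

(** * Quadratic forms and the Loewner order *)

(** An arbitrary policy may let [Sigma] grow without bound, so no estimate uniform in time is
    available, and the order of the choices matters. The mixing proportion [d] is fixed first and
    determines the tolerance [e]; the horizon [tau] is then taken large; the mesh comes last. The
    Euler, Lipschitz and positivity constants may therefore degenerate with [tau]. Only the boundary
    term has to be controlled uniformly, and it is: [P(tau)] is nonnegative and is dropped, which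
    leaves [P(0) / tau].

    The solution is given only in integral form, entry by entry. That [Sigma t] is symmetric and
    positive definite, without which [P] makes no sense, must itself be derived from Euler steps:
    symmetry as a discrete uniqueness statement, positivity as a lower bound propagated along a
    grid.

    Most matrix inequalities below come from evaluating a nonnegative form at one well-chosen
    vector. Spectral theory enters only for the square root and for Lyapunov matrices. *)

Definition qform (R : realType) (n : nat) (A : 'M[R]_n) (x : 'cV[R]_n) : R :=
  (x^T *m A *m x) 0 0.

(** A norm chosen for convenience: it is submultiplicative, invariant under transposition, read off
    from entrywise bounds, and it dominates both the trace and the quadratic form on unit
    vectors. *)
Definition mx_norm1 (R : realType) (m n : nat) (A : 'M[R]_(m, n)) : R :=
  \sum_a \sum_b `|A a b|.

Section Loewner.
Context {R : realType}.
Implicit Types (m n : nat).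

Lemma symmetricmxP n (A : 'M[R]_n) : reflect (A^T = A) (A \is symmetricmx).
Proof.
by apply: (iffP (is_hermitianmxP _ _ _)); rewrite expr0 scale1r map_mx_id.
Qed.

Lemma qformD n (A B : 'M[R]_n) x : qform (A + B) x = qform A x + qform B x.
Proof. by rewrite /qform mulmxDr mulmxDl mxE. Qed.

Lemma qformN n (A : 'M[R]_n) x : qform (- A) x = - qform A x.
Proof. by rewrite /qform mulmxN mulNmx mxE. Qed.

Lemma qformB n (A B : 'M[R]_n) x : qform (A - B) x = qform A x - qform B x.
Proof. by rewrite qformD qformN. Qed.

Lemma qformZ n c (A : 'M[R]_n) x : qform (c *: A) x = c * qform A x.
Proof. by rewrite /qform -scalemxAr -scalemxAl mxE. Qed.

Lemma qform0 n (x : 'cV[R]_n) : qform 0 x = 0.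
Proof. by rewrite /qform mulmx0 mul0mx mxE. Qed.

Lemma qform_sum n (I : Type) (r : seq I) (P : pred I) (A : I -> 'M[R]_n) x :
  qform (\sum_(i <- r | P i) A i) x = \sum_(i <- r | P i) qform (A i) x.
Proof.
by apply: (big_morph (fun B => qform B x)) => [B C|]; rewrite ?qformD ?qform0.
Qed.

Lemma qform_congr m n (B : 'M[R]_(m, n)) (A : 'M[R]_m) x :
  qform (B^T *m A *m B) x = qform A (B *m x).
Proof. by rewrite /qform trmx_mul !mulmxA. Qed.

Lemma trmx11 (A : 'M[R]_1) : A^T 0 0 = A 0 0.
Proof. by rewrite mxE. Qed.

Lemma mx11D (A B : 'M[R]_1) : (A + B) 0 0 = A 0 0 + B 0 0.
Proof. by rewrite mxE. Qed.

Lemma qform_tr n (A : 'M[R]_n) x : qform A^T x = qform A x.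
Proof. by rewrite /qform -[RHS]trmx11 !trmx_mul trmxK mulmxA. Qed.

Lemma qformZr n (A : 'M[R]_n) c x : qform A (c *: x) = c ^+ 2 * qform A x.
Proof.
rewrite /qform [(c *: x)^T]linearZ /= -!scalemxAl -scalemxAr scalerA.
by rewrite [LHS]mxE expr2.
Qed.

Lemma qform1 n (x : 'cV[R]_n) : qform 1%:M x = \sum_i x i 0 ^+ 2.
Proof. by rewrite /qform mulmx1 mxE; apply: eq_bigr => i _; rewrite mxE. Qed.

Lemma qform_scalar n c (x : 'cV[R]_n) : qform c%:M x = c * qform 1%:M x.
Proof. by rewrite -[c%:M]scalemx1 qformZ. Qed.

Lemma qform1_ge0 n (x : 'cV[R]_n) : 0 <= qform 1%:M x.
Proof. by rewrite qform1 sumr_ge0 // => i _; rewrite sqr_ge0. Qed.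

Lemma qform1_gt0 n (x : 'cV[R]_n) : x != 0 -> 0 < qform 1%:M x.
Proof.
move=> x0; rewrite lt_neqAle qform1_ge0 andbT eq_sym qform1 psumr_eq0; last first.
  by move=> i _; rewrite sqr_ge0.
apply: contra x0 => /allP x0; apply/eqP/matrixP => i j; rewrite ord1 mxE.
by apply/eqP; rewrite -sqrf_eq0; apply: x0; rewrite mem_index_enum.
Qed.

Lemma sqr_entry_le n (x : 'cV[R]_n) i : x i 0 ^+ 2 <= qform 1%:M x.
Proof.
rewrite qform1 (bigD1 i) //= lerDl sumr_ge0 // => j _; exact: sqr_ge0.
Qed.

Lemma bilinear_sym n (A : 'M[R]_n) (x y : 'cV[R]_n) : A^T = A ->
  (x^T *m A *m y) 0 0 = (y^T *m A *m x) 0 0.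
Proof. by move=> sA; rewrite -[RHS]trmx11 !trmx_mul trmxK sA mulmxA. Qed.

Lemma bilinearZ m n (A : 'M[R]_(m, n)) (x : 'cV[R]_m) (y : 'cV[R]_n) c d :
  ((c *: x)^T *m A *m (d *: y)) 0 0 = c * d * (x^T *m A *m y) 0 0.
Proof.
rewrite [(c *: x)^T]linearZ /= -!scalemxAl -scalemxAr scalerA.
by rewrite [LHS]mxE.
Qed.

Lemma qform_cross n (A : 'M[R]_n) (x y : 'cV[R]_n) : A^T = A ->
  qform A (x + y) = qform A x + (x^T *m A *m y) 0 0 *+ 2 + qform A y.
Proof.
move=> sA; rewrite /qform [(x + y)^T]linearD /= !mulmxDl !mulmxDr !mx11D mulr2n.
by rewrite (bilinear_sym y x sA) !addrA.
Qed.

Lemma psd_sym n (A : 'M[R]_n) : psdmx A -> A^T = A.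
Proof. by case=> /symmetricmxP. Qed.

Lemma pd_sym n (A : 'M[R]_n) : pdmx A -> A^T = A.
Proof. by case=> /symmetricmxP. Qed.

Lemma psdP n (A : 'M[R]_n) :
  A^T = A -> (forall x, 0 <= qform A x) -> psdmx A.
Proof. by move=> /symmetricmxP sA A0; split. Qed.

Lemma pdP n (A : 'M[R]_n) :
  A^T = A -> (forall x, x != 0 -> 0 < qform A x) -> pdmx A.
Proof. by move=> /symmetricmxP sA A0; split. Qed.

Lemma psd_qform n (A : 'M[R]_n) x : psdmx A -> 0 <= qform A x.
Proof. by case=> _; apply. Qed.

Lemma pd_qform n (A : 'M[R]_n) x : pdmx A -> x != 0 -> 0 < qform A x.
Proof. by case=> _; apply. Qed.

Lemma pd_psd n (A : 'M[R]_n) : pdmx A -> psdmx A.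
Proof.
move=> Apd; apply: psdP => [|x]; first exact: pd_sym.
by have [->|/(pd_qform Apd)/ltW//] := eqVneq x 0; rewrite /qform mulmx0 mxE.
Qed.

Lemma loewner_qform n (A B : 'M[R]_n) x : A ⪯ B -> qform A x <= qform B x.
Proof. by move=> AB; rewrite -subr_ge0 -qformB psd_qform. Qed.

Lemma loewner_leP n (A B : 'M[R]_n) : A^T = A -> B^T = B ->
  (forall x, qform A x <= qform B x) -> A ⪯ B.
Proof.
move=> sA sB AB; apply: psdP => [|x]; first by rewrite linearB /= sA sB.
by rewrite qformB subr_ge0.
Qed.

Lemma loewner0 n (A : 'M[R]_n) : (0 ⪯ A) = psdmx A.
Proof. by rewrite /loewner_le subr0. Qed.

Lemma loewner_lt0 n (A : 'M[R]_n) : (0 ≺ A) = pdmx A.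
Proof. by rewrite /loewner_lt subr0. Qed.

Lemma psdD n (A B : 'M[R]_n) : psdmx A -> psdmx B -> psdmx (A + B).
Proof.
move=> Ap Bp; apply: psdP => [|x]; first by rewrite linearD /= !psd_sym.
by rewrite qformD addr_ge0 ?psd_qform.
Qed.

Lemma psdZ n c (A : 'M[R]_n) : 0 <= c -> psdmx A -> psdmx (c *: A).
Proof.
move=> c0 Ap; apply: psdP => [|x]; first by rewrite linearZ /= psd_sym.
by rewrite qformZ mulr_ge0 ?psd_qform.
Qed.

Lemma psd0 n : psdmx (0 : 'M[R]_n).
Proof. by apply: psdP => [|x]; rewrite ?trmx0 ?qform0. Qed.

Lemma psd_sum n (I : Type) (r : seq I) (P : pred I) (A : I -> 'M[R]_n) :
  (forall i, P i -> psdmx (A i)) -> psdmx (\sum_(i <- r | P i) A i).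
Proof. by move=> Ap; apply: big_ind => //; [exact: psd0 | exact: psdD]. Qed.

Lemma psd_congr m n (B : 'M[R]_(m, n)) (A : 'M[R]_m) :
  psdmx A -> psdmx (B^T *m A *m B).
Proof.
move=> Ap; apply: psdP => [|x]; last by rewrite qform_congr psd_qform.
by rewrite !trmx_mul trmxK (psd_sym Ap) mulmxA.
Qed.

Lemma psd_scalar n c : 0 <= c -> psdmx (c%:M : 'M[R]_n).
Proof.
move=> c0; apply: psdP => [|x]; first by rewrite tr_scalar_mx.
by rewrite qform_scalar mulr_ge0 ?qform1_ge0.
Qed.

Lemma loewner_trans n (B A C : 'M[R]_n) : A ⪯ B -> B ⪯ C -> A ⪯ C.
Proof.
by move=> AB BC; have := psdD BC AB; rewrite /loewner_le addrA subrK.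
Qed.

Lemma loewner_scalar n (a b : R) : a <= b -> (a%:M : 'M[R]_n) ⪯ b%:M.
Proof. by rewrite /loewner_le -raddfB -subr_ge0; exact: psd_scalar. Qed.

Lemma psd_pdD n (A B : 'M[R]_n) : psdmx A -> pdmx B -> pdmx (A + B).
Proof.
move=> Ap Bp; apply: pdP => [|x x0].
  by rewrite linearD /= psd_sym // pd_sym.
by rewrite qformD ltr_wpDl ?psd_qform ?pd_qform.
Qed.

Lemma pdZ n c (A : 'M[R]_n) : 0 < c -> pdmx A -> pdmx (c *: A).
Proof.
move=> c0 Ap; apply: pdP => [|x x0]; first by rewrite linearZ /= pd_sym.
by rewrite qformZ mulr_gt0 ?pd_qform.
Qed.

Lemma pd_scalar n c : 0 < c -> pdmx (c%:M : 'M[R]_n).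
Proof.
move=> c0; apply: pdP => [|x x0]; first by rewrite tr_scalar_mx.
by rewrite qform_scalar mulr_gt0 ?qform1_gt0.
Qed.

Lemma pd_of_lower_bound n k (A : 'M[R]_n) : 0 < k -> k%:M ⪯ A -> pdmx A.
Proof. by move=> k0 kA; rewrite -(subrK k%:M A); apply: psd_pdD => //; exact: pd_scalar. Qed.

Lemma pd_unit n (A : 'M[R]_n) : pdmx A -> A \in unitmx.
Proof.
move=> Ap; rewrite -unitmx_tr -row_free_unit; apply/row_freeP.
suff : row_free A^T by move/row_freeP.
rewrite -kermx_eq0; apply/eqP/row_matrixP => i; rewrite row0; apply: contrapT => r0.
have := pd_qform Ap (x := (row i (kermx A^T))^T).
rewrite trmx_eq0 => /(_ (introN eqP r0)).
have ker0 : row i (kermx A^T) *m A = 0.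
  by rewrite -{2}(pd_sym Ap) -row_mul mulmx_ker row0.
by rewrite /qform trmxK ker0 mul0mx mxE ltxx.
Qed.

Lemma invmx_sym n (A : 'M[R]_n) : A^T = A -> (invmx A)^T = invmx A.
Proof. by move=> sA; rewrite trmx_inv sA. Qed.

Lemma qform_invmx n (A : 'M[R]_n) x : A^T = A -> A \in unitmx ->
  qform A (invmx A *m x) = qform (invmx A) x.
Proof.
move=> sA uA; rewrite -qform_congr invmx_sym // mulVmx // mul1mx //.
Qed.

Lemma pd_inv n (A : 'M[R]_n) : pdmx A -> pdmx (invmx A).
Proof.
move=> Ap; have uA := pd_unit Ap; have sA := pd_sym Ap.
apply: pdP => [|x x0]; first exact: invmx_sym.
rewrite -qform_invmx // pd_qform //; apply: contra x0 => /eqP x0.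
by rewrite -(mulKVmx uA x) x0 mulmx0.
Qed.

(** * Norm estimates for matrices, forms and inverses *)

Lemma mx_norm1_ge0 m n (A : 'M[R]_(m, n)) : 0 <= mx_norm1 A.
Proof. by rewrite sumr_ge0 // => a _; rewrite sumr_ge0. Qed.

Lemma entry_le_norm1 m n (A : 'M[R]_(m, n)) a b : `|A a b| <= mx_norm1 A.
Proof.
rewrite /mx_norm1 (bigD1 a) //= (bigD1 b) //= -addrA lerDl addr_ge0 ?sumr_ge0 //.
by move=> i _; rewrite sumr_ge0.
Qed.

Lemma mx_norm1_bound m n (A : 'M[R]_(m, n)) c :
  (forall a b, `|A a b| <= c) -> mx_norm1 A <= c *+ n *+ m.
Proof.
move=> Ac; rewrite -[X in _ *+ X]card_ord -sumr_const ler_sum // => a _.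
by rewrite -[X in _ *+ X]card_ord -sumr_const ler_sum.
Qed.

Lemma mx_norm1D m n (A B : 'M[R]_(m, n)) :
  mx_norm1 (A + B) <= mx_norm1 A + mx_norm1 B.
Proof.
rewrite /mx_norm1 -big_split ler_sum //= => a _; rewrite -big_split ler_sum //= => b _.
by rewrite mxE ler_normD.
Qed.

Lemma mx_norm1N m n (A : 'M[R]_(m, n)) : mx_norm1 (- A) = mx_norm1 A.
Proof. by apply: eq_bigr => a _; apply: eq_bigr => b _; rewrite mxE normrN. Qed.

Lemma mx_norm1B m n (A B : 'M[R]_(m, n)) :
  mx_norm1 (A - B) <= mx_norm1 A + mx_norm1 B.
Proof. by rewrite -(mx_norm1N B) mx_norm1D. Qed.

Lemma mx_norm1_0 m n : mx_norm1 (0 : 'M[R]_(m, n)) = 0.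
Proof. by rewrite /mx_norm1 big1 // => a _; rewrite big1 // => b _; rewrite mxE normr0. Qed.

Lemma mx_norm1Z m n c (A : 'M[R]_(m, n)) : mx_norm1 (c *: A) = `|c| * mx_norm1 A.
Proof.
rewrite /mx_norm1 mulr_sumr; apply: eq_bigr => a _; rewrite mulr_sumr.
by apply: eq_bigr => b _; rewrite mxE normrM.
Qed.

Lemma mx_norm1_tr m n (A : 'M[R]_(m, n)) : mx_norm1 A^T = mx_norm1 A.
Proof.
rewrite /mx_norm1 exchange_big; apply: eq_bigr => a _; apply: eq_bigr => b _.
by rewrite mxE.
Qed.

Lemma mx_norm1_sum m n (I : Type) (r : seq I) (P : pred I) (A : I -> 'M[R]_(m, n)) :
  mx_norm1 (\sum_(i <- r | P i) A i) <= \sum_(i <- r | P i) mx_norm1 (A i).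
Proof.
elim/big_rec2: _ => [|i c B _ Bc]; first by rewrite mx_norm1_0.
by rewrite (le_trans (mx_norm1D _ _)) // lerD2l.
Qed.

Lemma mx_norm1M m n p (A : 'M[R]_(m, n)) (B : 'M[R]_(n, p)) :
  mx_norm1 (A *m B) <= mx_norm1 A * mx_norm1 B.
Proof.
rewrite /mx_norm1 mulr_suml ler_sum // => a _.
apply: (@le_trans _ _ (\sum_b \sum_k `|A a k| * `|B k b|)).
  apply: ler_sum => b _; rewrite mxE (le_trans (ler_norm_sum _ _ _)) //.
  by apply: ler_sum => k _; rewrite normrM.
rewrite exchange_big mulr_suml ler_sum //= => k _.
rewrite -mulr_sumr ler_wpM2l // [leRHS](bigD1 k) //= lerDl sumr_ge0 // => i _.
by rewrite sumr_ge0.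
Qed.

Lemma tr_le_norm1 n (A : 'M[R]_n) : `|\tr A| <= mx_norm1 A.
Proof.
rewrite /mxtrace (le_trans (ler_norm_sum _ _ _)) // ler_sum // => a _.
by rewrite (bigD1 a) //= lerDl sumr_ge0.
Qed.

Lemma qform_le_norm1 n (A : 'M[R]_n) x :
  `|qform A x| <= mx_norm1 A * qform 1%:M x.
Proof.
have -> : qform A x = \sum_a \sum_b x a 0 * A a b * x b 0.
  rewrite /qform mxE exchange_big; apply: eq_bigr => b _; rewrite mxE mulr_suml.
  by apply: eq_bigr => a _; rewrite mxE.
rewrite (le_trans (ler_norm_sum _ _ _)) // /mx_norm1 mulr_suml ler_sum // => a _.
rewrite (le_trans (ler_norm_sum _ _ _)) // mulr_suml ler_sum // => b _.
rewrite mulrAC !normrM mulrC ler_wpM2l //.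
have := sqr_entry_le x a; have := sqr_entry_le x b.
have := sqr_ge0 (`|x a 0| - `|x b 0|); rewrite -(real_normK (num_real (x a 0))).
rewrite -(real_normK (num_real (x b 0))); nra.
Qed.

(** The form of [A] at [x - c A^-1 x] is nonnegative, so [x^T A x >= 2 c |x|^2 - c^2 x^T A^-1 x].
    With [c = 1 / (m + 1)] and [m] a bound on [A^-1], the last term is at most [c |x|^2]. *)
Lemma pd_lower_bound n (A : 'M[R]_n) : pdmx A -> exists2 k, 0 < k & k%:M ⪯ A.
Proof.
move=> Ap; have uA := pd_unit Ap; have sA := pd_sym Ap.
pose m := mx_norm1 (invmx A); have m0 : 0 <= m by exact: mx_norm1_ge0.
pose c := (m + 1)^-1; have c0 : 0 < c by rewrite invr_gt0 ltr_wpDl.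
exists c => //; apply: loewner_leP => // [|x]; first by rewrite tr_scalar_mx.
rewrite qform_scalar; have := psd_qform (x - c *: (invmx A *m x)) (pd_psd Ap).
rewrite qform_cross // mulmxN mxE -scaleNr -scalemxAr.
have -> : qform A (- c *: (invmx A *m x)) = c ^+ 2 * qform (invmx A) x.
  by rewrite qformZr sqrrN qform_invmx.
rewrite mxE mulmxA mulmxK // -/(qform _ _) -[x^T]mulmx1 -/(qform 1%:M x).
have := le_trans (ler_norm _) (qform_le_norm1 (invmx A) x); rewrite -/m.
have := qform1_ge0 x; have : c * (m + 1) = 1 by rewrite mulVf // gt_eqF ?ltr_wpDl.
set q := qform _ x; set s := qform (invmx A) x; set r := qform A x => cm q0 sq.
have : c ^+ 2 * s <= c ^+ 2 * (m * q) by rewrite ler_wpM2l ?sqr_ge0.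
have -> : c ^+ 2 * (m * q) = c * (c * (m + 1)) * q - c ^+ 2 * q by ring.
rewrite cm mulr1 => h1 h2; have : 0 <= c ^+ 2 * q by rewrite mulr_ge0 ?sqr_ge0.
rewrite -mulr_natr in h2 *; lra.
Qed.

(** Every column [y = A^-1 e] has length at most [1 / k]: the hypothesis gives
    [k |y|^2 <= y^T A y = y^T e], and expanding [|e - k y|^2 >= 0] bounds [y^T e] in turn. The
    multiplicity counts the entries. *)
Lemma invmx_bound n k (A : 'M[R]_n) : 0 < k -> k%:M ⪯ A ->
  mx_norm1 (invmx A) <= k^-1 *+ n *+ n.
Proof.
move=> k0 kA; have Ap := pd_of_lower_bound k0 kA.
have uA := pd_unit Ap; have sA := pd_sym Ap.
apply: mx_norm1_bound => a b.
pose e : 'cV[R]_n := delta_mx b 0; pose y := invmx A *m e.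
have ya : invmx A a b = y a 0 by rewrite /y -colE mxE.
have q1 : qform 1%:M e = 1.
  rewrite qform1 (bigD1 b) //= big1 ?addr0 ?mxE ?eqxx ?expr1n //.
  by move=> i ib; rewrite mxE (negbTE ib) expr0n.
have h1 : k * qform 1%:M y <= qform A y.
  by rewrite -qform_scalar; exact: loewner_qform.
have h2 : qform A y = (y^T *m 1%:M *m e) 0 0.
  have Ay : A *m y = e by rewrite /y mulKVmx.
  by rewrite mulmx1 /qform -mulmxA Ay.
have := qform1_ge0 (e + (- k) *: y).
rewrite qform_cross ?tr_scalar_mx // -scalemxAr mxE q1.
rewrite (bilinear_sym e y (tr_scalar_mx _ _)) -h2 qformZr sqrrN.
rewrite -mulr_natr => h3.
have : k * qform 1%:M y * k <= k ^-1 * k.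
  rewrite mulVf ?gt_eqF //.
  have : k * (k * qform 1%:M y) <= k * qform A y by rewrite ler_pM2l.
  lra.
rewrite ler_pM2r // => h4.
rewrite ya -(ler_pXn2r (n:=2)) ?nnegrE ?invr_ge0 ?(ltW k0) //.
rewrite real_normK ?num_real // (le_trans (sqr_entry_le _ _)) //.
by rewrite -(ler_pM2l k0) (le_trans h4) // expr2 mulrA mulfV ?mul1r // gt_eqF.
Qed.

End Loewner.

(** * Square roots and Jensen inequalities *)

Section SquareRoot.
Context {R : realType}.
Implicit Types (m n : nat).

Local Notation "M ^t*" := (map_mx Num.conj M^T) (at level 30).
Local Notation toC := (map_mx (real_complex R)).

Lemma poly_interpolation (K : fieldType) (s : seq K) (g : K -> K) :
  exists f : {poly K}, {in s, forall x, f.[x] = g x}.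
Proof.
elim: s => [|x s [f fs]]; first by exists 0.
have [xs|xs] := boolP (x \in s).
  by exists f => y; rewrite inE => /predU1P[->|]; exact: fs.
pose w := \prod_(y <- s) ('X - y%:P).
have wx : w.[x] != 0 by rewrite -rootE root_prod_XsubC.
exists (f + ((g x - f.[x]) / w.[x]) *: w) => y; rewrite inE => /predU1P[->|ys].
  by rewrite !hornerE divfK // addrCA subrr addr0.
have /rootP wy : root w y by rewrite root_prod_XsubC.
by rewrite hornerD hornerZ wy mulr0 addr0 fs.
Qed.

Lemma trmx_horner_mx n (A : 'M[R]_n.+1) (p : {poly R}) :
  A^T = A -> (horner_mx A p)^T = horner_mx A p.
Proof.
move=> sA; elim/poly_ind: p => [|p c IHp]; first by rewrite rmorph0 trmx0.
rewrite rmorphD rmorphM /= horner_mx_X horner_mx_C linearD /= tr_scalar_mx.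
by rewrite trmx_mul IHp sA; congr (_ + _); exact: comm_mx_horner.
Qed.

Lemma toC_trC m n (A : 'M[R]_(m, n)) : (toC A) ^t* = toC A^T.
Proof. by apply/matrixP => i j; rewrite !mxE; exact: conjc_real. Qed.

(** Transfers nonnegativity of a real form to complex vectors, and hence to the eigenvalues read off
    from a unitary diagonalisation. *)
Lemma Re_hermitian_form n (A : 'M[R]_n) (z : 'rV[R[i]]_n) :
  complex.Re ((z *m toC A *m z ^t*) 0 0) =
  qform A (map_mx (@complex.Re R) z)^T + qform A (map_mx (@complex.Im R) z)^T.
Proof.
rewrite /qform !mxE (raddf_sum (@complex.Re R : Rcomplex R -> R)) -big_split.
apply: eq_bigr => b _ /=; rewrite !mxE !mulr_suml -big_split.
rewrite (raddf_sum (@complex.Re R : Rcomplex R -> R)); apply: eq_bigr => a _ /=.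
by rewrite !mxE; case: (z 0 a) => u v; case: (z 0 b) => u' v' /=; ring.
Qed.

(* The root is a real polynomial in [W]: interpolate the square root on the
   spectrum of [W], which is real and nonnegative. *)
Lemma psd_sqrt n (W : 'M[R]_n) : psdmx W -> exists S, psdmx S /\ S *m S = W.
Proof.
case: n W => [|n] W Wp.
  by exists 0; split; [exact: psd0 | rewrite [LHS]flatmx0 [RHS]flatmx0].
have hW : toC W \is hermsymmx.
  by apply/is_hermitianmxP; rewrite expr0 scale1r toC_trC psd_sym.
have := hermitian_spectral_diag_real hW.
have /orthomx_spectralP := hermitian_normalmx hW.
have Pu := spectral_unitarymx (toC W); move: Pu.
set P := spectralmx _; set d := spectral_diag _ => Pu Wd /mxOverP d_real.
have Punit := unitarymx_unit Pu.
have d0 k : 0 <= complex.Re (d 0 k).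
  have -> : d 0 k = (row k P *m toC W *m (row k P) ^t*) 0 0.
    have : P *m toC W *m P ^t* = diag_mx d.
      by rewrite Wd !mulmxA -invmx_unitary // mulmxV // mul1mx -mulmxA mulmxV // mulmx1.
    move=> /matrixP /(_ k k); rewrite [RHS]mxE eqxx mulr1n => <-.
    by rewrite -row_mul !mxE; apply: eq_bigr => j _; rewrite !mxE.
  by rewrite Re_hermitian_form addr_ge0 ?psd_qform.
have dR k : d 0 k = (complex.Re (d 0 k))%:C%C by rewrite RRe_real.
(* The interpolant [f] takes fourth roots: the square root of [W] is then the square of the
   symmetric matrix [f(W)], hence visibly positive semidefinite. *)
have [f fP] := poly_interpolation [seq complex.Re (d 0 k) | k : 'I_n.+1]
  (fun x => Num.sqrt (Num.sqrt x)).
have fW : horner_mx W (f ^+ 4) = W.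
  apply: (map_mx_inj (f := real_complex R)); rewrite map_horner_mx /=.
  rewrite {1}Wd horner_mx_uconjC // horner_mx_diag.
  rewrite [RHS]Wd; congr (_ *m diag_mx _ *m _); apply/matrixP => i k.
  rewrite ord1 mxE [in RHS]dR {1}dR horner_map /=; congr (_%:C%C).
  rewrite horner_exp fP; last by apply: map_f; rewrite mem_enum.
  by rewrite -[4%N]/(2 * 2)%N exprM !sqr_sqrtr ?sqrtr_ge0.
exists (horner_mx W f *m horner_mx W f); split; last first.
  by rewrite -[RHS]fW !exprS expr0 mulr1 !rmorphM /= -!mulmxE !mulmxA.
have := psd_congr (horner_mx W f) (@psd_scalar R n.+1 1 ler01).
by rewrite mulmx1 trmx_horner_mx // psd_sym.
Qed.

Lemma sqrtmxP n (W : 'M[R]_n) : psdmx W ->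
  psdmx (sqrtmx W) /\ sqrtmx W *m sqrtmx W = W.
Proof. by move=> /psd_sqrt[S SW]; rewrite /sqrtmx; case: xgetP => // /(_ S). Qed.

(** With [A = S S], cyclicity turns the trace into that of [S^T B S], whose diagonal entries are
    values of a nonnegative form. *)
Lemma tr_mul_psd n (A B : 'M[R]_n) : psdmx A -> psdmx B -> 0 <= \tr (A *m B).
Proof.
move=> /psd_sqrt[S [Sp <-]] Bp.
rewrite mxtrace_mulC mulmxA mxtrace_mulC mulmxA -{1}(psd_sym Sp).
have := psd_congr S Bp; set C := S^T *m _ *m _ => Cp.
rewrite sumr_ge0 // => i _; have := psd_qform (delta_mx i 0) Cp.
by rewrite /qform trmx_delta -rowE -colE !mxE.
Qed.

Lemma loewner_tr n (T A B : 'M[R]_n) : psdmx T -> A ⪯ B ->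
  \tr (T *m A) <= \tr (T *m B).
Proof.
by move=> Tp AB; rewrite -subr_ge0 -linearB /= -mulmxBr; exact: tr_mul_psd.
Qed.

End SquareRoot.

Section Jensen.
Context {R : realType} (n : nat) (I : finType) (w : I -> R).
Context (w_ge0 : forall k, 0 <= w k) (w_sum : \sum_k w k = 1).

(** The tangent inequality [y^T W y >= 2 z^T W y - z^T W z], taken at the mean [z] and averaged, has
    right-hand side [z^T W z]. *)
Lemma qform_Jensen (W : 'M[R]_n) (y : I -> 'cV[R]_n) : psdmx W ->
  qform W (\sum_k w k *: y k) <= \sum_k w k * qform W (y k).
Proof.
move=> Wp; set z := \sum_k _ *: _.
have le_k k : 2 * (z^T *m W *m y k) 0 0 - qform W z <= qform W (y k).
  have := psd_qform (z + (- 1) *: y k) Wp.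
  rewrite (qform_cross _ _ (psd_sym Wp)) qformZr -scalemxAr [in X in _ <= X]mxE; lra.
have : \sum_k w k * (2 * (z^T *m W *m y k) 0 0 - qform W z)
    <= \sum_k w k * qform W (y k).
  by apply: ler_sum => k _; rewrite ler_wpM2l.
apply: le_trans; under eq_bigr => k _ do rewrite mulrBr mulrCA.
rewrite big_split /= -mulr_sumr sumrN -mulr_suml w_sum mul1r.
suff <- : qform W z = \sum_k w k * (z^T *m W *m y k) 0 0 by lra.
rewrite /qform {2}/z mulmx_sumr summxE; apply: eq_bigr => k _.
by rewrite -scalemxAr mxE.
Qed.

Context (P : I -> 'M[R]_n).
Let Q := \sum_k w k *: P k.

(** By symmetry [x^T P W P x] is the form of [W] at [P x], which is linear in [P]; the vector
    inequality applies. *)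
Lemma congr_Jensen (W : 'M[R]_n) : psdmx W -> (forall k, (P k)^T = P k) ->
  Q *m W *m Q ⪯ \sum_k w k *: (P k *m W *m P k).
Proof.
move=> Wp Ps; have sW := psd_sym Wp.
have sQ : Q^T = Q by rewrite /Q linear_sum; apply: eq_bigr => k _; rewrite linearZ /= Ps.
apply: loewner_leP => [||x].
- by rewrite !trmx_mul sQ sW mulmxA.
- rewrite linear_sum; apply: eq_bigr => k _.
  by rewrite linearZ /= !trmx_mul Ps sW mulmxA.
rewrite -{1}sQ qform_congr qform_sum /Q mulmx_suml.
under eq_bigr => k _ do rewrite -scalemxAl.
apply: (le_trans (qform_Jensen _ Wp)); apply: ler_sum => k _.
by rewrite qformZ -{2}(Ps k) qform_congr.
Qed.

(** Variational form of the inverse: [x^T P^-1 x] is the maximum over [y] of [2 x^T y - y^T P y], a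
    supremum of affine functions of [P]. The choice [y = Q^-1 x] is optimal for the mean. *)
Lemma invmx_Jensen : (forall k, pdmx (P k)) -> pdmx Q ->
  invmx Q ⪯ \sum_k w k *: invmx (P k).
Proof.
move=> Pp Qp; have uQ := pd_unit Qp.
apply: loewner_leP => [||x]; first exact/invmx_sym/pd_sym.
  rewrite linear_sum; apply: eq_bigr => k _.
  by rewrite linearZ /= invmx_sym // pd_sym.
pose y := invmx Q *m x.
have le_k k : 2 * qform (invmx Q) x - qform (P k) y <= qform (invmx (P k)) x.
  have sP := pd_sym (Pp k); have uP := pd_unit (Pp k).
  have := psd_qform (invmx (P k) *m x + (- 1) *: y) (pd_psd (Pp k)).
  rewrite qform_cross // qformZr -scalemxAr [in X in _ <= X]mxE qform_invmx //.
  have -> : ((invmx (P k) *m x)^T *m P k *m y) 0 0 = qform (invmx Q) x.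
    by rewrite trmx_mul invmx_sym // -(mulmxA x^T) mulVmx // mulmx1 /qform mulmxA.
  lra.
have : \sum_k w k * (2 * qform (invmx Q) x - qform (P k) y)
    <= \sum_k w k * qform (invmx (P k)) x.
  by apply: ler_sum => k _; rewrite ler_wpM2l.
under eq_bigr => k _ do rewrite mulrBr.
rewrite big_split /= -mulr_suml w_sum mul1r sumrN.
have -> : \sum_k w k * qform (P k) y = qform (invmx Q) x.
  rewrite -qform_invmx //; last exact: pd_sym.
  by rewrite -/y /Q qform_sum; apply: eq_bigr => k _; rewrite qformZ.
rewrite qform_sum; under [X in _ -> _ <= X]eq_bigr => k _ do rewrite qformZ.
lra.
Qed.

End Jensen.

(** * Lyapunov matrices *)

Section Lyapunov.
Context {R : realType}.
Implicit Types (m n : nat).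

Local Notation "M ^t*" := (map_mx Num.conj M^T) (at level 30).
Local Notation toC := (map_mx (real_complex R)).

(** An explicit bound in place of a minimum, so that an empty index set needs no separate case. *)
Lemma finite_pos_lower_bound (I : finType) (f : I -> R) :
  (forall k, 0 < f k) -> exists2 mu : R, 0 < mu & forall k, mu <= f k.
Proof.
move=> f0; pose s := \sum_k (f k)^-1.
have s0 : 0 <= s by rewrite sumr_ge0 // => k _; rewrite invr_ge0 ltW.
exists (s + 1)^-1 => [|k]; first by rewrite invr_gt0 ltr_wpDl.
rewrite -[leRHS]invrK lef_pV2 ?posrE ?invr_gt0 ?ltr_wpDl //.
rewrite ler_wpDr // /s (bigD1 k) //= lerDl sumr_ge0 // => j _.
by rewrite invr_ge0 ltW.
Qed.

Lemma normr_dot2_le (p q r s t : R) :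
  p ^+ 2 + q ^+ 2 <= t -> r ^+ 2 + s ^+ 2 <= t -> `|p * r + q * s| <= t.
Proof.
have := sqr_ge0 (p - r); have := sqr_ge0 (p + r).
have := sqr_ge0 (q - s); have := sqr_ge0 (q + s); rewrite ler_norml; nra.
Qed.

Lemma Re_sum (I : Type) (r : seq I) (P : pred I) (F : I -> R[i]) :
  complex.Re (\sum_(i <- r | P i) F i) = \sum_(i <- r | P i) complex.Re (F i).
Proof. exact: (raddf_sum (@complex.Re R : Rcomplex R -> R)). Qed.

Lemma Re_bilinear m n (B : 'M[R[i]]_(m, n)) (x : 'cV[R]_m) (y : 'cV[R]_n) :
  (x^T *m map_mx (@complex.Re R) B *m y) 0 0 =
  complex.Re ((toC x^T *m B *m toC y) 0 0).
Proof.
rewrite !mxE Re_sum; apply: eq_bigr => b _ /=; rewrite !mxE !mulr_suml Re_sum.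
apply: eq_bigr => a _ /=; rewrite !mxE; case: (B a b) => u v /=; ring.
Qed.

Lemma trC_mul m n p (B : 'M[R[i]]_(m, n)) (D : 'M[R[i]]_(n, p)) :
  (B *m D) ^t* = D ^t* *m B ^t*.
Proof. by rewrite trmx_mul; exact: map_mxM. Qed.

Lemma Re_gram m n (Y : 'M[R[i]]_(m, n)) (x y : 'cV[R]_n) :
  (x^T *m map_mx (@complex.Re R) (Y ^t* *m Y) *m y) 0 0 =
  complex.Re (((Y *m toC x) ^t* *m (Y *m toC y)) 0 0).
Proof.
by rewrite Re_bilinear trC_mul toC_trC !mulmxA.
Qed.

Lemma eigenvalue_trig n (L : 'M[R[i]]_n) a : is_trig_mx L -> eigenvalue L (L a a).
Proof.
move=> Ltrig; rewrite eigenvalue_root_char char_poly_trig // /root horner_prod.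
by rewrite prodf_seq_eq0; apply/hasP; exists a; rewrite ?mem_index_enum //= !hornerE subrr.
Qed.

(* Triangularise [A] as [P A = L P]; rescaling the coordinates by the powers of a
   small [e] makes the off-diagonal part of [L] negligible. *)
Lemma hurwitz_lyapunov n (A : 'M[R]_n) : hurwitz A ->
  exists X, pdmx X /\ pdmx (- (X *m A + A^T *m X)).
Proof.
case: n A => [|n] A hA.
  by exists 0; split; apply: pdP => [|x]; rewrite ?[_^T]flatmx0 ?[LHS]flatmx0 ?[RHS]flatmx0 // [x]flatmx0 eqxx.
have [P Pu Ptrig] := Schur (toC A) (ltn0Sn n).
have Punit := unitarymx_unit Pu.
pose L := P *m toC A *m P ^t*.
have Ltrig : is_trig_mx L by rewrite /L -conjymx.
have PA : P *m toC A = L *m P.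
  by rewrite /L -mulmxA -invmx_unitary // mulVmx // mulmx1.
have Leig a : complex.Re (L a a) < 0.
  apply: hA; apply: (eigenvalue_conjmx (V := P)).
  - exact: stablemx_unit.
  - by rewrite row_free_unit.
  - by rewrite conjymx //; exact: eigenvalue_trig.
have [mu mu0 muL] : exists2 mu : R, 0 < mu & forall a, mu <= - complex.Re (L a a).
  by apply: finite_pos_lower_bound => a; rewrite oppr_gt0.
pose K a b : R := `|complex.Re (L a b)| + `|complex.Im (L a b)|.
pose K1 : R := \sum_a \sum_b K a b.
have K10 : 0 <= K1.
  by rewrite sumr_ge0 // => a _; rewrite sumr_ge0 // => b _; rewrite addr_ge0.
(* Chosen so that [e <= 1] and [e * K1 < mu]: all entries of [L] together, once damped by [e], weigh
   less than the distance [mu] of the spectrum from the imaginary axis. *)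
pose e : R := mu / (mu + K1 + 1).
have den0 : 0 < mu + K1 + 1 by rewrite ltr_wpDl // addr_ge0 // ltW.
have e0 : 0 < e by rewrite divr_gt0.
have e1 : e <= 1 by rewrite ler_pdivrMr // mul1r -addrA lerDl addr_ge0.
have eK : e * K1 < mu.
  by rewrite /e mulrAC ltr_pdivrMr // ltr_pM2l //; lra.
clearbody e.
have K0 a b : 0 <= K a b by rewrite addr_ge0.
(* The rescaled coordinates. On real vectors the real part of the Gram matrix of [Y] gives the same
   form as the Gram matrix itself, so [qform X x] is the squared length [S x] of [Y x]. *)
pose Y : 'M[R[i]]_n.+1 := \matrix_(a, b) ((e ^+ a)%:C%C * P a b).
pose X := map_mx (@complex.Re R) (Y ^t* *m Y).
have sX : X^T = X.
  apply/matrixP => a b; rewrite !mxE !Re_sum; apply: eq_bigr => k _.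
  rewrite !mxE; case: (P k a) => u v; case: (P k b) => u' v' /=; ring.
have Yx (x : 'cV[R]_n.+1) a : (Y *m toC x) a 0 = (e ^+ a)%:C%C * (P *m toC x) a 0.
  by rewrite !mxE mulr_sumr; apply: eq_bigr => b _; rewrite !mxE mulrA.
pose u (x : 'cV[R]_n.+1) (a : 'I_n.+1) : R := e ^+ a * complex.Re ((P *m toC x) a 0).
pose v (x : 'cV[R]_n.+1) (a : 'I_n.+1) : R := e ^+ a * complex.Im ((P *m toC x) a 0).
pose S x : R := \sum_a (u x a ^+ 2 + v x a ^+ 2).
have S_ge x a : u x a ^+ 2 + v x a ^+ 2 <= S x.
  rewrite /S (bigD1 a) //= lerDl sumr_ge0 // => b _.
  by rewrite addr_ge0 ?sqr_ge0.
have S0 x : 0 <= S x by rewrite sumr_ge0 // => a _; rewrite addr_ge0 ?sqr_ge0.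
have Sgt (x : 'cV[R]_n.+1) : x != 0 -> 0 < S x.
  move=> x0; rewrite lt_neqAle S0 andbT eq_sym; apply: contra x0 => /eqP Sx0.
  have : P *m toC x = 0.
    apply/matrixP => a b; rewrite ord1 [RHS]mxE; apply/eqP; rewrite eq_complex /=.
    have := S_ge x a; rewrite Sx0 => h.
    have ea : e ^+ a != 0 by rewrite expf_neq0 // gt_eqF.
    have /eqP : u x a = 0 by have := sqr_ge0 (u x a); have := sqr_ge0 (v x a); nra.
    have /eqP : v x a = 0 by have := sqr_ge0 (u x a); have := sqr_ge0 (v x a); nra.
    by rewrite !mulf_eq0 (negbTE ea) /= => -> ->.
  move=> /(congr1 (mulmx (invmx P))); rewrite mulKmx // mulmx0 => tx0.
  by apply/eqP/(map_mx_inj (f := real_complex R)); rewrite tx0 map_mx0.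
have qX x : qform X x = S x.
  rewrite /qform Re_gram mxE Re_sum; apply: eq_bigr => a _.
  rewrite [X in X * _]mxE [X in Num.conj X]mxE !Yx /u /v.
  by case: ((P *m toC x) a 0) => s t /=; ring.
have qXA (x : 'cV[R]_n.+1) : x != 0 -> (x^T *m X *m (A *m x)) 0 0 < 0.
  move=> x0; rewrite Re_gram mxE Re_sum.
  have -> : \sum_(a < n.+1) complex.Re ((Y *m toC x) ^t* 0 a * (Y *m toC (A *m x)) a 0) =
      \sum_(a < n.+1) \sum_(b < n.+1) (e ^+ a * complex.Re (L a b) * (u x a * complex.Re ((P *m toC x) b 0)
        + v x a * complex.Im ((P *m toC x) b 0)) + e ^+ a * complex.Im (L a b) *
        (v x a * complex.Re ((P *m toC x) b 0) - u x a * complex.Im ((P *m toC x) b 0))).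
    apply: eq_bigr => a _; rewrite [X in X * _]mxE [X in Num.conj X]mxE !Yx.
    rewrite map_mxM mulmxA PA -mulmxA [X in _ * (_ * X)]mxE !mulr_sumr Re_sum.
    apply: eq_bigr => b _; rewrite /u /v.
    case: (L a b) => l m; case: ((P *m toC x) a 0) => s t.
    by case: ((P *m toC x) b 0) => s' t' /=; ring.
  (* The diagonal contributes at most [- mu * S x]. As [L] is lower triangular, a nonzero
     off-diagonal entry has [b < a] and carries the factor [e ^+ (a - b) <= e]. The total is at most
     [(e * K1 - mu) * S x]. *)
  apply: (@le_lt_trans _ _ (\sum_(a < n.+1) (- mu * (u x a ^+ 2 + v x a ^+ 2) +
    \sum_(b < n.+1) e * K a b * S x))).
    apply: ler_sum => a _; rewrite (bigD1 a) //= [in leRHS](bigD1 a) //=.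
    rewrite addrA; apply: lerD.
      have : 0 <= e * K a a * S x.
        by rewrite !mulr_ge0 // ltW.
      have := muL a; have := sqr_ge0 (u x a); have := sqr_ge0 (v x a).
      have -> : e ^+ a * complex.Re (L a a) * (u x a * complex.Re ((P *m toC x) a 0)
          + v x a * complex.Im ((P *m toC x) a 0)) =
         complex.Re (L a a) * (u x a ^+ 2 + v x a ^+ 2) by rewrite /u /v; ring.
      have -> : e ^+ a * complex.Im (L a a) * (v x a * complex.Re ((P *m toC x) a 0)
          - u x a * complex.Im ((P *m toC x) a 0)) = 0 by rewrite /u /v; ring.
      nra.
    apply: ler_sum => b ba.
    have [ab|ab] := ltnP a b.
      move/is_trig_mxP: Ltrig => /(_ _ _ ab) -> /=.
      by rewrite !mulr0 !mul0r addr0 !mulr_ge0 // ltW.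
    have {}ab : (b < a)%N by rewrite ltn_neqAle ab andbT.
    have ea : e ^+ a = e ^+ (a - b) * e ^+ b by rewrite -exprD subnK // ltnW.
    have eab : e ^+ (a - b) <= e.
      by rewrite -[leRHS]expr1 ler_wiXn2l ?(ltW e0) // subn_gt0.
    have eab0 : 0 <= e ^+ (a - b) by rewrite exprn_ge0 // ltW.
    have -> : e ^+ a * complex.Re (L a b) * (u x a * complex.Re ((P *m toC x) b 0)
        + v x a * complex.Im ((P *m toC x) b 0)) =
        e ^+ (a - b) * (complex.Re (L a b) * (u x a * u x b + v x a * v x b)).
      by rewrite ea /u /v; ring.
    have -> : e ^+ a * complex.Im (L a b) * (v x a * complex.Re ((P *m toC x) b 0)
        - u x a * complex.Im ((P *m toC x) b 0)) =
        e ^+ (a - b) * (complex.Im (L a b) * (v x a * u x b + - u x a * v x b)).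
      by rewrite ea /u /v; ring.
    rewrite -mulrDr -mulrA.
    have KS : complex.Re (L a b) * (u x a * u x b + v x a * v x b) +
        complex.Im (L a b) * (v x a * u x b + - u x a * v x b) <= K a b * S x.
      rewrite /K mulrDl; apply: lerD; rewrite (le_trans (ler_norm _)) // normrM ler_wpM2l //.
        exact: (normr_dot2_le (S_ge x a) (S_ge x b)).
      apply: (normr_dot2_le _ (S_ge x b)).
      by rewrite sqrrN addrC.
    apply: (@le_trans _ _ (e ^+ (a - b) * (K a b * S x))); first by rewrite ler_wpM2l.
    by rewrite ler_wpM2r // mulr_ge0.
  rewrite big_split /= -mulr_sumr -/(S x).
  under eq_bigr => a _ do rewrite -mulr_suml -mulr_sumr.
  rewrite -mulr_suml -mulr_sumr -/K1; have := Sgt x x0; nra.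
exists X; split; first by apply: pdP => // x x0; rewrite qX Sgt.
apply: pdP => [|x x0]; first by rewrite linearN linearD /= !trmx_mul trmxK sX addrC.
rewrite qformN oppr_gt0 qformD.
have -> : qform (A^T *m X) x = qform (X *m A) x by rewrite -qform_tr trmx_mul trmxK sX.
have := qXA x x0; rewrite !mulmxA -(mulmxA _ X) -/(qform _ x); lra.
Qed.

(* A small multiple of a Lyapunov matrix of [A - L C]. *)
Lemma detectable_strict_riccati n m (q : 'I_m -> nat) (A W : 'M[R]_n)
    (C : forall j, 'M[R]_(q j, n)) (V : forall j, 'M[R]_(q j))
    r (js : 'I_r -> 'I_m) (c : R) :
  psdmx W -> (forall j, pdmx (V j)) ->
  detectable A (\mxcol_k C (js k)) -> 0 < c ->
  exists Q eta, [/\ pdmx Q, 0 < eta &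
    Q *m A + A^T *m Q + Q *m W *m Q - \sum_j c *: info_mx (C j) (V j)
      ⪯ (- eta)%:M].
Proof.
move=> Wp Vp [L /hurwitz_lyapunov[X [Xp]]] /pd_lower_bound[k k0 kX] c0.
set Ct := \mxcol_k _ in kX; have sX := pd_sym Xp.
pose G x := \sum_j qform (info_mx (C j) (V j)) x.
have [v v0 vV] : exists2 v, 0 < v & forall j, v%:M ⪯ invmx (V j).
  have vex j : exists v, 0 < v /\ v%:M ⪯ invmx (V j).
    by have [v] := pd_lower_bound (pd_inv (Vp j)); exists v.
  pose f j := projT1 (cid (vex j)).
  have [v v0 vf] := finite_pos_lower_bound (fun j => (projT2 (cid (vex j))).1).
  exists v => // j; apply: loewner_trans (projT2 (cid (vex j))).2.
  rewrite /loewner_le -raddfB; apply: psd_scalar; rewrite subr_ge0; exact: vf.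
have info0 j x : 0 <= qform (info_mx (C j) (V j)) x.
  by apply: psd_qform; apply: psd_congr; exact/pd_psd/pd_inv.
have G0 x : 0 <= G x by exact: sumr_ge0.
(* Each stacked block belongs to some sensor, so its squared output is at most [G x / v]; the factor
   [r] also accounts for sensors repeated in [js]. *)
have CtG x : qform 1%:M (Ct *m x) <= r%:R / v * G x.
  rewrite -qform_congr mulmx1 /Ct tr_mxcol mul_mxrow_mxcol qform_sum.
  rewrite mulrAC -mulrA mulr_natl -[X in _ *+ X]card_ord -sumr_const ler_sum // => l _.
  rewrite ler_pdivlMr // mulrC -[_ *m C _]mulmx1.
  have -> : (C (js l))^T *m C (js l) = (C (js l))^T *m 1%:M *m C (js l) by rewrite mulmx1.
  rewrite mulmx1 qform_congr -qform_scalar.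
  apply: (@le_trans _ _ (qform (info_mx (C (js l)) (V (js l))) x)).
    by rewrite /info_mx qform_congr; exact: loewner_qform.
  by rewrite /G (bigD1 (js l)) //= lerDl sumr_ge0.
pose nu := mx_norm1 (X *m L *m (X *m L)^T); have nu0 : 0 <= nu by exact: mx_norm1_ge0.
(* Weight in [2 y^T z <= a |y|^2 + |z|^2 / a], which splits the gain term [X L C]: with
   [a * nu <= k / 2], half of the decay [k] survives, and the rest is charged to the outputs. *)
pose a := k / (2 * (nu + 1)); have a0 : 0 < a by rewrite divr_gt0 // mulr_gt0 // ltr_wpDl.
have anu : a * nu <= k / 2.
  rewrite /a mulrAC ler_pdivrMr ?mulr_gt0 ?ltr_wpDl //; nra.
clearbody a.
pose lam := r%:R / v / a.
have lam0 : 0 <= lam by rewrite /lam !divr_ge0 ?(ltW v0) ?(ltW a0).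
have XA x : qform (X *m A + A^T *m X) x <= - (k / 2) * qform 1%:M x + lam * G x.
  have := loewner_qform x kX; rewrite qform_scalar qformN qformD.
  have -> : qform ((A - L *m Ct)^T *m X) x = qform (X *m (A - L *m Ct)) x.
    by rewrite -qform_tr trmx_mul trmxK sX.
  rewrite qformD.
  have -> : qform (A^T *m X) x = qform (X *m A) x by rewrite -qform_tr trmx_mul trmxK sX.
  rewrite mulmxBr qformB => h.
  pose y := (X *m L)^T *m x; pose z := Ct *m x.
  have yz : qform (X *m (L *m Ct)) x = (y^T *m 1%:M *m z) 0 0.
    by rewrite mulmx1 /y trmx_mul trmxK /qform /z !mulmxA.
  have yy : qform 1%:M y <= nu * qform 1%:M x.
    rewrite /y -qform_congr mulmx1 trmxK.
    by rewrite (le_trans (ler_norm _)) // qform_le_norm1.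
  have := qform1_ge0 (a *: y + (- 1) *: z).
  rewrite qform_cross ?tr_scalar_mx // !qformZr bilinearZ -yz.
  have aV : a * a^-1 = 1 by rewrite mulfV // gt_eqF.
  have := CtG x; rewrite -/z /lam => zG h2.
  have h3 : 2 * qform (X *m (L *m Ct)) x <= a * qform 1%:M y + a^-1 * qform 1%:M z.
    have ai0 : 0 < a^-1 by rewrite invr_gt0.
    have : 0 <= a^-1 * (a ^+ 2 * qform 1%:M y - 2 * a * qform (X *m (L *m Ct)) x + qform 1%:M z).
      by rewrite mulr_ge0 ?(ltW ai0) //; move: h2; rewrite -mulr_natr; lra.
    have -> : a^-1 * (a ^+ 2 * qform 1%:M y - 2 * a * qform (X *m (L *m Ct)) x + qform 1%:M z)
      = (a * a^-1) * (a * qform 1%:M y - 2 * qform (X *m (L *m Ct)) x) + a^-1 * qform 1%:M z by ring.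
    by rewrite aV; lra.
  have h4 : a * qform 1%:M y <= k / 2 * qform 1%:M x.
    apply: (@le_trans _ _ (a * (nu * qform 1%:M x))); first by rewrite ler_pM2l.
    by rewrite mulrA ler_wpM2r ?qform1_ge0.
  have h5 : a^-1 * qform 1%:M z <= r%:R / v / a * G x.
    by rewrite [X in _ <= X * _]mulrC -mulrA ler_pM2l ?invr_gt0.
  lra.
pose om := mx_norm1 (X *m W *m X); have om0 : 0 <= om by exact: mx_norm1_ge0.
(* The first bound lets the information [c * G x] absorb the output term [eps * lam * G x]; the
   second lets the quadratic term use up half of the remaining decay [k / 2], which leaves
   [k / 4]. *)
pose eps := Num.min (c / (lam + 1)) (k / (4 * (om + 1))).
have eps0 : 0 < eps by rewrite lt_min !divr_gt0 ?mulr_gt0 ?ltr_wpDl.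
have eps_lam : eps * lam <= c.
  apply: (@le_trans _ _ (c / (lam + 1) * lam)).
    by rewrite ler_wpM2r // ge_min lexx.
  by rewrite mulrAC ler_pdivrMr ?ltr_wpDl //; nra.
have eps_om : eps * om <= k / 4.
  apply: (@le_trans _ _ (k / (4 * (om + 1)) * om)).
    by rewrite ler_wpM2r // ge_min lexx orbT.
  by rewrite mulrAC ler_pdivrMr ?mulr_gt0 ?ltr_wpDl //; nra.
exists (eps *: X), (eps * (k / 4)); split; first exact: pdZ.
  by rewrite !mulr_gt0 ?invr_gt0.
have sW := psd_sym Wp.
apply: loewner_leP => [||x].
- rewrite linearB !linearD /= !trmx_mul trmxK [(eps *: X)^T]linearZ /= sX sW.
  rewrite [_ + A^T *m _]addrC !mulmxA; congr (_ - _).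
  rewrite linear_sum; apply: eq_bigr => j _.
  by rewrite linearZ /= psd_sym //; apply: psd_congr; exact/pd_psd/pd_inv.
- by rewrite tr_scalar_mx.
rewrite qform_scalar qformB qformD qform_sum.
have -> : \sum_j qform (c *: info_mx (C j) (V j)) x = c * G x.
  by rewrite mulr_sumr; apply: eq_bigr => j _; rewrite qformZ.
rewrite -!scalemxAl -!scalemxAr -scalerDr scalerA !qformZ.
have := XA x; have := le_trans (ler_norm _) (qform_le_norm1 (X *m W *m X) x).
rewrite -/om; set t := qform (X *m W *m X) x; set s := qform (_ + _) x.
have := qform1_ge0 x; set N := qform 1%:M x => N0 tN sN.
have h1 : eps * s <= eps * (- (k / 2) * N + lam * G x) by rewrite ler_pM2l.
have h2 : eps * eps * t <= eps * (eps * om) * N.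
  by rewrite -!mulrA !ler_pM2l // mulrA mulrC.
have h3 : eps * (eps * om) * N <= eps * (k / 4) * N.
  by rewrite ler_wpM2r // ler_pM2l.
have h4 : eps * lam * G x <= c * G x by rewrite ler_wpM2r.
lra.
Qed.

End Lyapunov.

(** * Primitives on the half line *)

Section HalfLineIntegral.
Context {R : realType}.
Implicit Types (f g : R -> R) (s t c K : R).

Local Notation mu := (@lebesgue_measure R).

Definition integrable_half_line f :=
  forall t, 0 <= t -> mu.-integrable `[0, t] (EFin \o f).

Definition primitive f t := \int[mu]_(s in `[0, t]) f s.

Lemma integrable_half_line_sum (I : Type) (r : seq I) (P : pred I) (F : I -> R -> R) :
  (forall i, P i -> integrable_half_line (F i)) ->
  integrable_half_line (fun t => \sum_(i <- r | P i) F i t).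
Proof.
move=> iF t t0; rewrite (_ : EFin \o _ = fun x => (\sum_(i <- r | P i) (EFin \o F i) x)%E).
  by apply: integrable_sum => // i Pi; exact: iF.
by apply/funext => x /=; rewrite sumEFin.
Qed.

Lemma integrable_half_lineZ c f :
  integrable_half_line f -> integrable_half_line (fun t => c * f t).
Proof. by move=> iF t t0; exact: (integrableZl _ c (iF t t0)). Qed.

Lemma integrable_half_lineD f g : integrable_half_line f ->
  integrable_half_line g -> integrable_half_line (fun t => f t + g t).
Proof. by move=> fi gi t t0; exact: (integrableD _ (fi t t0) (gi t t0)). Qed.

Lemma integrable_half_lineB f g : integrable_half_line f ->
  integrable_half_line g -> integrable_half_line (fun t => f t - g t).
Proof. by move=> fi gi t t0; exact: (integrableB _ (fi t t0) (gi t t0)). Qed.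

Lemma lebesgue_segment_lty s t : (mu `[s, t] < +oo)%E.
Proof.
by rewrite /= lebesgue_measure_itv /=; case: ifP => // _; rewrite -EFinB ltry.
Qed.

Lemma integrable_half_line_cst c : integrable_half_line (fun=> c).
Proof.
move=> t t0; apply: measurable_bounded_integrable => //.
  exact: lebesgue_segment_lty.
by exists `|c|; split => // y cy x _ /=; exact: ltW.
Qed.

Lemma primitiveZ c f t : integrable_half_line f -> 0 <= t ->
  primitive (fun s => c * f s) t = c * primitive f t.
Proof. by move=> fi t0; rewrite /primitive RintegralZl //; exact: fi. Qed.

Lemma primitiveD f g t : integrable_half_line f -> integrable_half_line g ->
  0 <= t -> primitive (fun s => f s + g s) t = primitive f t + primitive g t.
Proof. by move=> fi gi t0; rewrite /primitive RintegralD //; [exact: fi|exact: gi]. Qed.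

Lemma primitiveB f g t : integrable_half_line f -> integrable_half_line g ->
  0 <= t -> primitive (fun s => f s - g s) t = primitive f t - primitive g t.
Proof. by move=> fi gi t0; rewrite /primitive RintegralB //; [exact: fi|exact: gi]. Qed.

Lemma primitive_sum (I : Type) (r : seq I) (F : I -> R -> R) t :
  (forall i, integrable_half_line (F i)) -> 0 <= t ->
  primitive (fun s => \sum_(i <- r) F i s) t = \sum_(i <- r) primitive (F i) t.
Proof.
move=> Fi t0; elim: r => [|i r IHr].
  rewrite big_nil /primitive -[RHS](@Rintegral_set0 _ _ _ mu (fun=> 0)).
  under eq_Rintegral do rewrite big_nil.
  by rewrite !Rintegral_cst // !mul0r.
rewrite big_cons -IHr -primitiveD //; last exact: integrable_half_line_sum.
by apply: eq_Rintegral => x _; rewrite big_cons.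
Qed.

Lemma primitive_cst c t : 0 <= t -> primitive (fun=> c) t = c * t.
Proof.
move=> t0; rewrite /primitive Rintegral_cst //= lebesgue_measure_itv /= lte_fin.
by case: ltgtP t0 => // [t0 _|<- _] /=; rewrite ?subr0 // mulr0.
Qed.

Lemma primitive0 f : primitive f 0 = 0.
Proof. by rewrite /primitive set_itv1 Rintegral_set1. Qed.

Lemma primitive_increment f s t : integrable_half_line f -> 0 <= s <= t ->
  primitive f t - primitive f s = \int[mu]_(r in `]s, t]) f r.
Proof.
move=> fi /andP[s0 st]; rewrite /primitive Rintegral_itvB ?bnd_simp //.
exact/fi/(le_trans s0).
Qed.

(** The substitute for differentiation. A constant [g] gives Lipschitz bounds and Riemann sums; the
    right-hand side with frozen state gives Euler steps. *)
Lemma primitive_close f g s t K : integrable_half_line f ->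
  integrable_half_line g -> 0 <= s <= t ->
  (forall r, s <= r <= t -> `|f r - g r| <= K) ->
  `|(primitive f t - primitive f s) - (primitive g t - primitive g s)| <= K * (t - s).
Proof.
move=> fi gi st fgK; have /andP[s0 le_st] := st; have t0 := le_trans s0 le_st.
have hi := integrable_half_lineB fi gi.
have -> : (primitive f t - primitive f s) - (primitive g t - primitive g s) =
    primitive (fun r => f r - g r) t - primitive (fun r => f r - g r) s.
  by rewrite !primitiveB //; lra.
rewrite primitive_increment //.
have sub : `]s, t] `<=` `[0, t].
  by move=> r /=; rewrite !in_itv /= => /andP[sr ->]; rewrite (le_trans s0) // ltW.
have hi' : mu.-integrable `]s, t] (EFin \o (fun r => f r - g r)).
  by apply: integrableS (hi t t0).
apply: (le_trans (le_normr_Rintegral _ hi')) => //.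
apply: (@le_trans _ _ (\int[mu]_(r in `]s, t]) K)).
  apply: le_Rintegral => //.
  - exact: (integrable_norm hi').
  - by apply: integrableS (integrable_half_line_cst K t0).
  - by move=> r /=; rewrite in_itv /= => /andP[sr rt]; apply: fgK; rewrite rt ltW.
rewrite Rintegral_cst //= lebesgue_measure_itv /= lte_fin.
have [->|lt_st] := eqVneq s t; first by rewrite ltxx subrr.
by rewrite lt_neqAle lt_st le_st.
Qed.

Lemma primitive_bounded f T : 0 <= T -> integrable_half_line f ->
  exists K, forall t, 0 <= t <= T -> `|primitive f t| <= K.
Proof.
move=> T0 fi; have cf := parameterized_integral_continuous T0 (fi T T0).
have [a _ fa] := EVT_max T0 cf; have [b _ fb] := EVT_min T0 cf.
exists (Num.max (primitive f a) (- primitive f b)) => t tT.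
rewrite ler_norml lerNl le_max le_max fa ?orbT // ?andbT; first by rewrite lerN2 fb ?orbT.
Qed.

Lemma primitive_continuous f T : 0 <= T -> integrable_half_line f ->
  {within `[0, T], continuous (primitive f)}.
Proof. by move=> T0 fi; exact: parameterized_integral_continuous T0 (fi T T0). Qed.

Lemma integrable_half_line_primitive c f : integrable_half_line f ->
  integrable_half_line (fun t => c + primitive f t).
Proof.
move=> fi; apply: integrable_half_lineD; first exact: integrable_half_line_cst.
move=> t t0; apply: continuous_compact_integrable; first exact: segment_compact.
exact: primitive_continuous.
Qed.

Lemma eq_integrable_half_line f g : (forall t, 0 <= t -> f t = g t) ->
  integrable_half_line f -> integrable_half_line g.
Proof.
move=> fg fi t t0; apply: eq_integrable (fi t t0) => // r.
by rewrite inE /= in_itv /= => /andP[r0 _]; rewrite fg.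
Qed.

Lemma integrable_half_line_indicator (b : R -> bool) :
  measurable_fun (`[0, +oo[ : set (measurableTypeR R)) b ->
  integrable_half_line (fun t => (b t)%:R).
Proof.
move=> mb t t0; apply: measurable_bounded_integrable => //.
- exact: lebesgue_segment_lty.
- rewrite (_ : (fun r => _) = fun r => if b r then 1 else 0); last first.
    by apply/funext => r; case: (b r).
  apply: measurable_fun_if => //; apply: measurable_funS mb => // r /=.
  by rewrite !in_itv /= => /andP[-> _].
- by exists 1; split => // y y1 x _ /=; case: (b x); rewrite ?normr1 ?normr0 ?ltW // (lt_trans _ y1).
Qed.

End HalfLineIntegral.

(** * The Riccati flow *)

Section Grid.
Context {R : realType}.

(** For [x = c t / N] the exponential stays below [exp (c t)] whatever [N] is, so local errors of
    order [1 / N^2] accumulate to order [1 / N]. *)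
Lemma discrete_gronwall (u : nat -> R) (N : nat) x y : 0 <= x -> 0 <= y -> 0 <= u 0%N ->
  (forall k, (k < N)%N -> u k.+1 <= (1 + x) * u k + y) ->
  forall k, (k <= N)%N -> u k <= expR (x * k%:R) * (u 0%N + y * k%:R).
Proof.
move=> x0 y0 u0 uS; elim=> [|k IHk] kN; first by rewrite !mulr0 expR0 mul1r addr0.
apply: (le_trans (uS k kN)).
have {}IHk := IHk (ltnW kN).
have e1 : 1 + x <= expR x by exact: expR_ge1Dx.
have ek : 1 <= expR (x * k.+1%:R) by apply: le_trans (expR_ge1Dx _); rewrite lerDl mulr_ge0.
have -> : expR (x * k.+1%:R) * (u 0%N + y * k.+1%:R) =
    expR x * (expR (x * k%:R) * (u 0%N + y * k%:R)) + expR (x * k.+1%:R) * y.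
  by rewrite -natr1 (mulrDr x) expRD mulr1; ring.
apply: lerD; last by rewrite ler_peMl.
apply: (@le_trans _ _ ((1 + x) * (expR (x * k%:R) * (u 0%N + y * k%:R)))).
  by rewrite ler_wpM2l // addr_ge0.
by rewrite ler_wpM2r // mulr_ge0 ?expR_ge0 // addr_ge0 // mulr_ge0.
Qed.

(** Turns the loss factor [1 - c h] of a step into an exponential rate; it rests on
    [(1 - x) (1 + 2 x) >= 1] for [x] in [[0, 1/2]]. *)
Lemma expRN_double_le (x : R) : 0 <= x <= 2^-1 -> expR (- (2 * x)) <= 1 - x.
Proof.
move=> /andP[x0 x1]; have e1 : 1 + 2 * x <= expR (2 * x) by exact: expR_ge1Dx.
rewrite expRN -div1r ler_pdivrMr ?expR_gt0 //.
have : (1 - x) * (1 + 2 * x) <= (1 - x) * expR (2 * x) by rewrite ler_wpM2l //; lra.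
nra.
Qed.

Lemma grid_point (T : R) N k : 0 <= T -> (k < N)%N ->
  [/\ 0 <= T / N%:R * k%:R <= T / N%:R * k.+1%:R, T / N%:R * k.+1%:R <= T
    & T / N%:R * k.+1%:R - T / N%:R * k%:R = T / N%:R].
Proof.
move=> T0 kN; have N0 : 0 < N%:R :> R by rewrite ltr0n (leq_ltn_trans _ kN).
have h0 : 0 <= T / N%:R by rewrite divr_ge0 // ltW.
split; last by rewrite -natr1; ring.
- by rewrite mulr_ge0 //= ler_wpM2l // ler_nat.
- by rewrite mulrAC ler_pdivrMr // ler_wpM2l // ler_nat.
Qed.

Lemma le0_of_le_div (a b : R) : (forall N, (0 < N)%N -> a <= b / N%:R) -> a <= 0.
Proof.
move=> ab; rewrite leNgt; apply/negP => a0.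
have b0 : 0 < b by apply: lt_le_trans a0 _; have := ab 1%N isT; rewrite divr1.
pose N := Num.bound (b / a); have N0 : b / a < N%:R.
  by apply: archi_boundP; rewrite divr_ge0 // ltW.
have Nn : 0 < N%:R :> R by apply: le_lt_trans N0; rewrite divr_ge0 // ltW.
have := ab N; rewrite -(ltr0n R) => /(_ Nn).
by rewrite leNgt ltr_pdivrMr // mulrC -ltr_pdivrMr // N0.
Qed.

End Grid.

Section RiccatiFlow.
Context {R : realType} (n m : nat) (A W : 'M[R]_n) (G : 'I_m -> 'M[R]_n).
Context (pi : 'I_m -> R -> bool) (Sigma0 : 'M[R]_n) (Sigma : R -> 'M[R]_n).

Definition active_info r := \sum_j (pi j r)%:R *: G j.

Definition riccati_rhs r (S : 'M[R]_n) :=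
  A *m S + S *m A^T + W - S *m active_info r *m S.

Context (W_psd : psdmx W) (G_psd : forall j, psdmx (G j)).
Context (pi_meas : forall j,
  measurable_fun (`[0, +oo[ : set (measurableTypeR R)) (pi j)).
Context (Sigma_ode : ode_solution riccati_rhs Sigma0 Sigma).

Definition use_time j := primitive (fun r => (pi j r)%:R : R).

(** The integral of [active_info] over [[s, t]]. *)
Definition info_increment s t := \sum_j (use_time j t - use_time j s) *: G j.

Definition drift (S : 'M[R]_n) := A *m S + S *m A^T + W.

Let gam := \sum_j mx_norm1 (G j).

Let gam0 : 0 <= gam.
Proof. by apply: sumr_ge0 => j _; exact: mx_norm1_ge0. Qed.

Lemma use_time_increment j s t : 0 <= s <= t ->
  0 <= use_time j t - use_time j s <= t - s.
Proof.
move=> st; have ip := integrable_half_line_indicator (pi_meas j).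
apply/andP; split.
  by rewrite /use_time primitive_increment // Rintegral_ge0.
have := primitive_close (K := 1) ip (integrable_half_line_cst 0) st.
have /andP[s0 st'] := st; have t0 := le_trans s0 st'.
rewrite !primitive_cst // !mul0r !subr0 mul1r => h.
apply: (le_trans (ler_norm _)); apply: h => r _; rewrite subr0.
by case: (pi j r); rewrite ?normr1 ?normr0.
Qed.

Lemma info_increment_psd s t : 0 <= s <= t -> psdmx (info_increment s t).
Proof.
move=> st; apply: psd_sum => j _; apply: psdZ => //.
by case/andP: (use_time_increment j st).
Qed.

Lemma info_increment_bound s t : 0 <= s <= t ->
  mx_norm1 (info_increment s t) <= gam * (t - s).
Proof.
move=> st; rewrite (le_trans (mx_norm1_sum _ _ _)) // mulr_suml ler_sum // => j _.
rewrite mx_norm1Z mulrC ler_wpM2l ?mx_norm1_ge0 //.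
by have /andP[c0 c1] := use_time_increment j st; rewrite ger0_norm.
Qed.

Let info_bound r : mx_norm1 (active_info r) <= gam.
Proof.
rewrite (le_trans (mx_norm1_sum _ _ _)) // ler_sum // => j _.
by rewrite mx_norm1Z; case: (pi j r); rewrite ?normr1 ?normr0 ?mul1r ?mul0r ?mx_norm1_ge0.
Qed.

Let rhs_integrable a b : integrable_half_line (fun r => riccati_rhs r (Sigma r) a b).
Proof. by move=> t t0; case: (Sigma_ode t0 a b). Qed.

Lemma ode_primitive t a b : 0 <= t ->
  Sigma t a b = Sigma0 a b + primitive (fun r => riccati_rhs r (Sigma r) a b) t.
Proof. by move=> t0; case: (Sigma_ode t0 a b). Qed.

Lemma ode_initial : Sigma 0 = Sigma0.
Proof. by apply/matrixP => a b; rewrite ode_primitive // primitive0 addr0. Qed.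

Lemma ode_entry_integrable a b : integrable_half_line (fun t => Sigma t a b).
Proof.
apply: eq_integrable_half_line (integrable_half_line_primitive (Sigma0 a b) (rhs_integrable a b)).
by move=> t t0; rewrite ode_primitive.
Qed.

(** Each entry is a constant plus a primitive, continuous and hence bounded on a compact interval;
    the bound may depend on [T]. *)
Lemma ode_bounded T : 0 <= T ->
  exists2 B, 0 < B & forall t, 0 <= t <= T -> mx_norm1 (Sigma t) <= B.
Proof.
move=> T0.
have hK a b := cid (primitive_bounded T0 (rhs_integrable a b)).
pose B := \sum_a \sum_b (`|Sigma0 a b| + `|projT1 (hK a b)|).
have B0 : 0 <= B by apply: sumr_ge0 => a _; apply: sumr_ge0 => b _; rewrite addr_ge0.
exists (B + 1) => [|t tT]; first by rewrite ltr_wpDl.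
apply: (@le_trans _ _ B); last by rewrite lerDl.
apply: ler_sum => a _; apply: ler_sum => b _.
rewrite ode_primitive; last by case/andP: tT.
rewrite (le_trans (ler_normD _ _)) // lerD2l.
exact: (le_trans (projT2 (hK a b) t tT) (ler_norm _)).
Qed.

Lemma ode_lipschitz T : 0 <= T -> exists2 K, 0 <= K &
  forall s t, 0 <= s <= t -> t <= T -> mx_norm1 (Sigma t - Sigma s) <= K * (t - s).
Proof.
move=> T0; have [B B0 SB] := ode_bounded T0.
pose K := 2 * mx_norm1 A * B + mx_norm1 W + B * gam * B.
have A0 := mx_norm1_ge0 A; have W0 := mx_norm1_ge0 W.
have K0 : 0 <= K.
  by rewrite !addr_ge0 // !mulr_ge0 // ltW.
exists (K *+ n *+ n) => [|s t st tT]; first by rewrite !mulrn_wge0.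
have /andP[s0 le_st] := st; have t0 := le_trans s0 le_st.
rewrite !mulrnAl; apply: mx_norm1_bound => a b.
rewrite !mxE !ode_primitive //.
have := primitive_close (K := K) (rhs_integrable a b) (integrable_half_line_cst 0) st.
rewrite !primitive_cst // !mul0r !subr0 => h.
rewrite [X in `|X|](_ : _ = primitive (fun r => riccati_rhs r (Sigma r) a b) t -
  primitive (fun r => riccati_rhs r (Sigma r) a b) s); last by ring.
apply: h => r /andP[sr rt]; rewrite subr0 (le_trans (entry_le_norm1 _ _ _)) //.
have SrB : mx_norm1 (Sigma r) <= B by apply: SB; rewrite (le_trans s0 sr) (le_trans rt).
have S0 := mx_norm1_ge0 (Sigma r).
rewrite (le_trans (mx_norm1B _ _)) // lerD //.
  rewrite (le_trans (mx_norm1D _ _)) // lerD2r (le_trans (mx_norm1D _ _)) //.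
  have := mx_norm1M A (Sigma r); have := mx_norm1M (Sigma r) A^T.
  by rewrite mx_norm1_tr; nra.
rewrite (le_trans (mx_norm1M _ _)) // ler_pM ?mx_norm1_ge0 //.
by rewrite (le_trans (mx_norm1M _ _)) // ler_pM ?mx_norm1_ge0.
Qed.

(** With the state frozen at [Sigma s], the right-hand side integrates exactly, the control
    contributing [info_increment s t]. By the Lipschitz bound, freezing changes the integrand by
    [O(t - s)], hence the integral by [O((t - s)^2)]. *)
Lemma ode_euler T : 0 <= T -> exists2 K, 0 <= K &
  forall s t, 0 <= s <= t -> t <= T ->
  mx_norm1 (Sigma t - Sigma s - ((t - s) *: drift (Sigma s)
    - Sigma s *m info_increment s t *m Sigma s)) <= K * (t - s) ^+ 2.
Proof.
move=> T0; have [B B0 SB] := ode_bounded T0; have [L L0 SL] := ode_lipschitz T0.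
pose K := 2 * (mx_norm1 A + gam * B) * L.
have A0 := mx_norm1_ge0 A.
have K0 : 0 <= K by rewrite !mulr_ge0 // addr_ge0 // mulr_ge0 // ltW.
exists (K *+ n *+ n) => [|s t st tT]; first by rewrite !mulrn_wge0.
have /andP[s0 le_st] := st; have t0 := le_trans s0 le_st.
rewrite !mulrnAl; apply: mx_norm1_bound => a b.
pose g r := drift (Sigma s) a b - \sum_j (Sigma s *m G j *m Sigma s) a b * (pi j r)%:R.
have rhsE r : riccati_rhs r (Sigma s) a b = g r.
  rewrite /g /riccati_rhs [LHS]mxE; congr (_ + _); rewrite [LHS]mxE; congr (- _).
  rewrite /active_info mulmx_sumr mulmx_suml summxE; apply: eq_bigr => j _.
  by rewrite -scalemxAr -scalemxAl mxE mulrC.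
have pii j : integrable_half_line (fun r => (pi j r)%:R) := integrable_half_line_indicator (pi_meas j).
have gi : integrable_half_line g.
  apply: integrable_half_lineB; first exact: integrable_half_line_cst.
  by apply: integrable_half_line_sum => j _; exact: integrable_half_lineZ.
have gE r : 0 <= r -> primitive g r =
    drift (Sigma s) a b * r - \sum_j (Sigma s *m G j *m Sigma s) a b * use_time j r.
  move=> r0; rewrite primitiveB //; first last.
  - by apply: integrable_half_line_sum => j _; exact: integrable_half_lineZ.
  - exact: integrable_half_line_cst.
  rewrite primitive_cst // primitive_sum //; last by move=> j; exact: integrable_half_lineZ.
  by congr (_ - _); apply: eq_bigr => j _; rewrite primitiveZ.
rewrite [X in `|X|](_ : _ = (primitive (fun r => riccati_rhs r (Sigma r) a b) t -
  primitive (fun r => riccati_rhs r (Sigma r) a b) s) - (primitive g t - primitive g s)); last first.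
  have entry (X Y Z U : 'M[R]_n) c :
      (X - Y - (c *: U - Z)) a b = X a b - Y a b - (c * U a b - Z a b).
    by rewrite !mxE.
  rewrite entry !gE // !ode_primitive //.
  have -> : (Sigma s *m info_increment s t *m Sigma s) a b =
      \sum_j (Sigma s *m G j *m Sigma s) a b * use_time j t -
      \sum_j (Sigma s *m G j *m Sigma s) a b * use_time j s.
    rewrite /info_increment mulmx_sumr mulmx_suml summxE -sumrB; apply: eq_bigr => j _.
    by rewrite -scalemxAr -scalemxAl mxE mulrC mulrBr.
  by ring.
rewrite (_ : K * (t - s) ^+ 2 = K * (t - s) * (t - s)); last by ring.
apply: primitive_close => // r /andP[sr rt]; rewrite -rhsE.
have r0 := le_trans s0 sr; have rT := le_trans rt tT.
have SrB : mx_norm1 (Sigma r) <= B by apply: SB; rewrite r0.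
have SsB : mx_norm1 (Sigma s) <= B by apply: SB; rewrite s0 (le_trans le_st).
pose D := Sigma r - Sigma s.
have DL : mx_norm1 D <= L * (t - s).
  apply: (le_trans (SL s r _ _)) => //; first by rewrite s0.
  by rewrite ler_wpM2l // lerD2r.
have -> : riccati_rhs r (Sigma r) a b - riccati_rhs r (Sigma s) a b =
    (A *m D + D *m A^T - (D *m active_info r *m Sigma r + Sigma s *m active_info r *m D)) a b.
  have -> : A *m D + D *m A^T - (D *m active_info r *m Sigma r + Sigma s *m active_info r *m D) =
      riccati_rhs r (Sigma r) - riccati_rhs r (Sigma s).
    rewrite /riccati_rhs /D mulmxBr !mulmxBl mulmxBr.
    move: (A *m _) (A *m _) (_ *m A^T) (_ *m A^T) (_ *m _ *m _) (_ *m _ *m _) (_ *m _ *m _).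
    by move=> M1 M2 M3 M4 M5 M6 M7; apply/matrixP => x y; rewrite !mxE; ring.
  by rewrite [RHS]mxE [X in _ = _ + X]mxE.
rewrite (le_trans (entry_le_norm1 _ _ _)) // (le_trans (mx_norm1B _ _)) //.
have D0 := mx_norm1_ge0 D.
have h1 : mx_norm1 (A *m D + D *m A^T) <= 2 * mx_norm1 A * mx_norm1 D.
  rewrite (le_trans (mx_norm1D _ _)) //.
  have := mx_norm1M A D; have := mx_norm1M D A^T; rewrite mx_norm1_tr; lra.
have h2 : mx_norm1 (D *m active_info r *m Sigma r + Sigma s *m active_info r *m D) <=
    2 * (gam * B) * mx_norm1 D.
  rewrite (le_trans (mx_norm1D _ _)) //.
  have : mx_norm1 (D *m active_info r *m Sigma r) <= mx_norm1 D * gam * B.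
    rewrite (le_trans (mx_norm1M _ _)) // ler_pM ?mx_norm1_ge0 //.
    by rewrite (le_trans (mx_norm1M _ _)) // ler_wpM2l.
  have : mx_norm1 (Sigma s *m active_info r *m D) <= B * gam * mx_norm1 D.
    rewrite (le_trans (mx_norm1M _ _)) // ler_wpM2r //.
    by rewrite (le_trans (mx_norm1M _ _)) // ler_pM ?mx_norm1_ge0.
  lra.
have : 2 * (mx_norm1 A + gam * B) * mx_norm1 D <= 2 * (mx_norm1 A + gam * B) * (L * (t - s)).
  by rewrite ler_wpM2l // mulr_ge0 // addr_ge0 // mulr_ge0 // ltW.
rewrite /K; lra.
Qed.

(** The transpose solves the same equation, so this is a uniqueness statement: the defect
    [Sigma - Sigma^T] starts at zero, grows by a factor [1 + c h] per step up to [O(h^2)], and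
    vanishes as the grid on [[0, t]] is refined. *)
Lemma ode_symmetric t : Sigma0^T = Sigma0 -> 0 <= t -> (Sigma t)^T = Sigma t.
Proof.
move=> sS0 t0; have [B B0 SB] := ode_bounded t0; have [K K0 SK] := ode_euler t0.
pose d r := mx_norm1 (Sigma r - (Sigma r)^T).
pose c := 2 * (mx_norm1 A + gam * B).
have c0 : 0 <= c.
  by rewrite mulr_ge0 // addr_ge0 ?mx_norm1_ge0 // mulr_ge0 // ltW.
have step s r : 0 <= s <= r -> r <= t ->
    d r <= (1 + c * (r - s)) * d s + 2 * K * (r - s) ^+ 2.
  move=> sr rt; have /andP[s0 le_sr] := sr.
  pose D := Sigma s - (Sigma s)^T; pose Y := info_increment s r.
  have sY : Y^T = Y by apply: psd_sym; exact: info_increment_psd.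
  pose E := Sigma r - Sigma s - ((r - s) *: drift (Sigma s) - Sigma s *m Y *m Sigma s).
  have EK : mx_norm1 E <= K * (r - s) ^+ 2 by exact: SK.
  (* With [S = Sigma s], [S Y S - S^T Y S^T = D Y S + S^T Y D]: apart from the Euler error the step
     is linear in the defect [D]. *)
  have -> : d r = mx_norm1 (D + ((r - s) *: (A *m D + D *m A^T) -
      (D *m Y *m Sigma s + (Sigma s)^T *m Y *m D)) + (E - E^T)).
    rewrite /d; congr mx_norm1.
    have -> : E^T = (Sigma r)^T - (Sigma s)^T - ((r - s) *: ((Sigma s)^T *m A^T +
        A *m (Sigma s)^T + W) - (Sigma s)^T *m Y *m (Sigma s)^T).
      rewrite /E !linearB /= linearZ /= /drift !linearD /= !trmx_mul trmxK sY.
      by rewrite (psd_sym W_psd) !mulmxA.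
    rewrite /E /D /drift !mulmxBr !mulmxBl.
    move: (A *m _) (A *m _) (_ *m A^T) (_ *m A^T) (_ *m _ *m _) (_ *m _ *m _) (_ *m _ *m _).
    move: (Sigma r) (Sigma r)^T (Sigma s) (Sigma s)^T => N1 N2 N3 N4.
    by move=> M1 M2 M3 M4 M5 M6 M7; apply/matrixP => x y; rewrite !mxE; ring.
  have SsB : mx_norm1 (Sigma s) <= B by apply: SB; rewrite s0 (le_trans le_sr).
  have YB : mx_norm1 Y <= gam * (r - s) by exact: info_increment_bound.
  have h0 : 0 <= r - s by rewrite subr_ge0.
  have D0 := mx_norm1_ge0 D; have A0 := mx_norm1_ge0 A.
  have h1 : mx_norm1 ((r - s) *: (A *m D + D *m A^T)) <= (r - s) * (2 * mx_norm1 A * mx_norm1 D).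
    rewrite mx_norm1Z ger0_norm // ler_wpM2l // (le_trans (mx_norm1D _ _)) //.
    have := mx_norm1M A D; have := mx_norm1M D A^T; rewrite mx_norm1_tr; lra.
  have h2 : mx_norm1 (D *m Y *m Sigma s + (Sigma s)^T *m Y *m D) <=
      2 * (mx_norm1 D * (gam * (r - s)) * B).
    rewrite (le_trans (mx_norm1D _ _)) //.
    have : mx_norm1 (D *m Y *m Sigma s) <= mx_norm1 D * (gam * (r - s)) * B.
      rewrite (le_trans (mx_norm1M _ _)) // ler_pM ?mx_norm1_ge0 //.
      by rewrite (le_trans (mx_norm1M _ _)) // ler_wpM2l.
    have : mx_norm1 ((Sigma s)^T *m Y *m D) <= B * (gam * (r - s)) * mx_norm1 D.
      rewrite (le_trans (mx_norm1M _ _)) // ler_wpM2r //.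
      by rewrite (le_trans (mx_norm1M _ _)) // ler_pM ?mx_norm1_ge0 // mx_norm1_tr.
    lra.
  rewrite (le_trans (mx_norm1D _ _)) //.
  have h3 : mx_norm1 (E - E^T) <= 2 * K * (r - s) ^+ 2.
    by rewrite (le_trans (mx_norm1B _ _)) // mx_norm1_tr; lra.
  apply: lerD => //; rewrite (le_trans (mx_norm1D _ _)) //.
  have -> : (1 + c * (r - s)) * d s = mx_norm1 D + ((r - s) * (2 * mx_norm1 A * mx_norm1 D)
      + 2 * (mx_norm1 D * (gam * (r - s)) * B)) by rewrite /c /d -/D; ring.
  by rewrite lerD2l (le_trans (mx_norm1B _ _)) // lerD.
suff d0 : d t = 0.
  apply/matrixP => a b; apply/esym/eqP; rewrite -subr_eq0 -normr_le0 -d0.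
  by have := entry_le_norm1 (Sigma t - (Sigma t)^T) a b; rewrite !mxE.
apply/eqP; rewrite eq_le mx_norm1_ge0 andbT.
apply: (@le0_of_le_div _ _ (expR (c * t) * (2 * K * t ^+ 2))) => N N0.
have N0' : 0 < N%:R :> R by rewrite ltr0n.
have h0 : 0 <= t / N%:R by rewrite divr_ge0 // ltW.
have tN : t / N%:R * N%:R = t by rewrite divfK ?gt_eqF.
have d00 : d 0 = 0 by rewrite /d ode_initial sS0 subrr mx_norm1_0.
have := @discrete_gronwall _ (fun k => d (t / N%:R * k%:R)) N (c * (t / N%:R))
  (2 * K * (t / N%:R) ^+ 2) _ _ _ _ N (leqnn N).
cbv beta; rewrite tN mulr0 d00 -(mulrA c) tN => h.
rewrite (le_trans (h _ _ _ _)) //.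
- by rewrite mulr_ge0.
- by rewrite !mulr_ge0 ?sqr_ge0.
- by move=> k kN; have [k1 k2 k3] := grid_point t0 kN; have := step _ _ k1 k2; rewrite k3.
rewrite add0r -(mulrA (expR _)) ler_wpM2l ?expR_ge0 //.
have -> // : 2 * K * (t / N%:R) ^+ 2 * N%:R = 2 * K * t ^+ 2 / N%:R.
have -> : 2 * K * t ^+ 2 / N%:R = 2 * K * t * (t / N%:R) by ring.
by rewrite -{2}tN; ring.
Qed.

(* Completing the square around [x + (h / (1 - h gam B)) A^T x] absorbs both the
   drift and the information term of an Euler step. *)
Lemma ode_lower_step T : Sigma0^T = Sigma0 -> 0 <= T ->
  exists c K d, [/\ 0 <= c, 0 <= K, 0 < d &
    forall s r, 0 <= s <= r -> r <= T -> r - s <= d ->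
    forall k, 0 <= k -> k%:M ⪯ Sigma s ->
    (k * (1 - c * (r - s)) - K * (r - s) ^+ 2)%:M ⪯ Sigma r].
Proof.
move=> sS0 T0; have [B B0 SB] := ode_bounded T0; have [K1 K10 SK] := ode_euler T0.
pose a := mx_norm1 A; have a0 : 0 <= a by exact: mx_norm1_ge0.
have gB : 0 <= gam * B by rewrite mulr_ge0 // ltW.
(* In the rate, [gam * B] is lost to the information term and [4 * a] to the change of vector from
   [x] to [w]. In the error, [K1] is the Euler error and the rest the remainder of the completed
   square. The bound on the step keeps [th = 1 - h * (gam * B)] above [1/2]. *)
exists (gam * B + 4 * a), (K1 + 2 * (B * (a * a))), (2 * (gam * B + 1))^-1; split.
- by rewrite addr_ge0 // mulr_ge0.
- by rewrite addr_ge0 // !mulr_ge0 // ltW.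
- by rewrite invr_gt0 mulr_gt0 // ltr_wpDl.
move=> s r sr rT rd k k0 kS; have /andP[s0 le_sr] := sr.
have r0 := le_trans s0 le_sr; have sT := le_trans le_sr rT.
set h := r - s in rd *; have h0 : 0 <= h by rewrite subr_ge0.
have hgB : h * (gam * B) <= 2^-1.
  apply: (@le_trans _ _ ((2 * (gam * B + 1))^-1 * (gam * B))); first by rewrite ler_wpM2r.
  by rewrite mulrC ler_pdivrMr ?mulr_gt0 ?ltr_wpDl //; lra.
pose Y := info_increment s r; pose S := Sigma s.
have sS : S^T = S by exact: ode_symmetric.
have sY : Y^T = Y by apply: psd_sym; exact: info_increment_psd.
have Sp : psdmx S.
  by rewrite -loewner0; apply: loewner_trans kS; rewrite -[0](raddf0 (@scalar_mx R n)); exact: loewner_scalar.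
have SBx x : qform S x <= B * qform 1%:M x.
  apply: (le_trans (le_trans (ler_norm _) (qform_le_norm1 _ _))).
  by rewrite ler_wpM2r ?qform1_ge0 // SB // s0.
apply: loewner_leP => [||x]; [by rewrite tr_scalar_mx|exact: ode_symmetric|].
rewrite qform_scalar; pose E := Sigma r - S - (h *: drift S - S *m Y *m S).
have E1 : - qform E x <= K1 * h ^+ 2 * qform 1%:M x.
  apply: (@le_trans _ _ `|qform E x|); first by rewrite ler_normr lexx orbT.
  by rewrite (le_trans (qform_le_norm1 _ _)) // ler_wpM2r ?qform1_ge0 // SK.
have N0 := qform1_ge0 x; set N := qform 1%:M x in E1 N0 *.
pose u := A^T *m x.
have uS : qform (A *m S) x = (u^T *m S *m x) 0 0.
  by rewrite /u trmx_mul trmxK /qform mulmxA.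
have uSt : qform (S *m A^T) x = (u^T *m S *m x) 0 0.
  by rewrite -uS -qform_tr trmx_mul trmxK sS.
have EE : qform E x = qform (Sigma r) x - qform S x -
    (h * ((u^T *m S *m x) 0 0 *+ 2 + qform W x) - qform (S *m Y *m S) x).
  by rewrite /E !qformB qformZ /drift !qformD uS uSt mulr2n.
(* That is [S^2 ⪯ B S], from the form of [S] at [x - S x / B]. The information term thus costs only
   a small fraction of [qform S x] itself, which can be charged to the rate. *)
have Sx2 : qform 1%:M (S *m x) <= B * qform S x.
  have := psd_qform (x + (- B^-1) *: (S *m x)) Sp; rewrite qform_cross // qformZr.
  rewrite -scalemxAr [X in X *+ 2]mxE.
  have -> : (x^T *m S *m (S *m x)) 0 0 = qform 1%:M (S *m x).
    by rewrite /qform mulmx1 trmx_mul sS.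
  have := SBx (S *m x); set z := qform 1%:M _ => zB.
  have BV : B * B^-1 = 1 by rewrite mulfV // gt_eqF.
  have Bi : 0 < B^-1 by rewrite invr_gt0.
  have : B^-1 ^+ 2 * qform S (S *m x) <= B^-1 ^+ 2 * (B * z) by rewrite ler_wpM2l ?sqr_ge0.
  have -> : B^-1 ^+ 2 * (B * z) = B * B^-1 * B^-1 * z by ring.
  rewrite BV mul1r sqrrN mulr2n => h1 h2.
  have : B * (B^-1 * z) <= B * qform S x by rewrite ler_pM2l //; lra.
  by rewrite mulrA BV mul1r.
have SYS : qform (S *m Y *m S) x <= h * (gam * B) * qform S x.
  rewrite -{1}sS qform_congr (le_trans (le_trans (ler_norm _) (qform_le_norm1 _ _))) //.
  apply: (@le_trans _ _ (gam * h * (B * qform S x))); last by rewrite le_eqVlt; apply/orP; left; apply/eqP; ring.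
  apply: ler_pM => //; [exact: mx_norm1_ge0|exact: qform1_ge0|exact: info_increment_bound].
have uu : qform 1%:M u <= a * a * N.
  rewrite /u -qform_congr mulmx1 trmxK (le_trans (le_trans (ler_norm _) (qform_le_norm1 _ _))) //.
  by rewrite ler_wpM2r // (le_trans (mx_norm1M _ _)) // mx_norm1_tr.
have Su : qform S u <= B * (a * a) * N.
  by rewrite (le_trans (SBx u)) // -(mulrA B) ler_pM2l.
have ux : - (x^T *m 1%:M *m u) 0 0 <= a * N.
  have -> : (x^T *m 1%:M *m u) 0 0 = qform A^T x by rewrite mulmx1 /u /qform mulmxA.
  rewrite qform_tr -qformN (le_trans (le_trans (ler_norm _) (qform_le_norm1 _ _))) //.
  by rewrite mx_norm1N.
pose th := 1 - h * (gam * B).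
have th2 : 2^-1 <= th by rewrite /th; lra.
have th0 : 0 < th by apply: lt_le_trans th2; rewrite invr_gt0.
have hgB0 : 0 <= h * (gam * B) by rewrite mulr_ge0.
have thV : th * th^-1 = 1 by rewrite mulfV // gt_eqF.
have thV2 : th^-1 <= 2 by rewrite -[leRHS]invrK lef_pV2 // posrE invr_gt0.
have thV0 : 0 < th^-1 by rewrite invr_gt0.
pose w := x + (h / th) *: u.
have qw : th * qform S w = th * qform S x + h * ((u^T *m S *m x) 0 0 *+ 2) +
    h ^+ 2 * th^-1 * qform S u.
  rewrite /w qform_cross // qformZr -scalemxAr [X in X *+ 2]mxE (bilinear_sym x u sS).
  set b := (_ *m _) 0 0.
  have -> : th * (qform S x + h / th * b *+ 2 + (h / th) ^+ 2 * qform S u) =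
    th * qform S x + (th * th^-1) * (h * (b *+ 2)) + (th * th^-1) * (h ^+ 2 * th^-1 * qform S u) by ring.
  by rewrite thV !mul1r.
have ww : (1 - 4 * a * h) * N <= qform 1%:M w.
  rewrite /w qform_cross ?tr_scalar_mx // qformZr -scalemxAr [X in X *+ 2]mxE -/N.
  have : 0 <= (h / th) ^+ 2 * qform 1%:M u by rewrite mulr_ge0 ?sqr_ge0 ?qform1_ge0.
  have h1 : - (h / th * (x^T *m 1%:M *m u) 0 0) <= h / th * (a * N).
    by rewrite -mulrN ler_wpM2l // mulr_ge0 // ltW.
  have h2 : h / th * (a * N) <= h * 2 * (a * N).
    by rewrite ler_wpM2r ?mulr_ge0 // ler_wpM2l.
  rewrite mulr2n; lra.
have kw : k * qform 1%:M w <= qform S w by rewrite -qform_scalar; exact: loewner_qform.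
have W0 := psd_qform x W_psd.
have h1 : th * (k * ((1 - 4 * a * h) * N)) <= th * qform S w.
  by rewrite ler_pM2l // (le_trans _ kw) // ler_wpM2l.
have h2 : h ^+ 2 * th^-1 * qform S u <= h ^+ 2 * 2 * (B * (a * a) * N).
  apply: ler_pM => //; [by rewrite mulr_ge0 ?sqr_ge0 // ltW|exact: psd_qform|].
  by rewrite ler_wpM2l ?sqr_ge0.
have h3 : 0 <= h * qform W x by rewrite mulr_ge0.
have h4 : k * (1 - h * (gam * B) - 4 * a * h) * N <= th * (k * ((1 - 4 * a * h) * N)).
  have -> : th * (k * ((1 - 4 * a * h) * N)) =
     k * (1 - h * (gam * B) - 4 * a * h) * N + k * (h * (gam * B)) * (4 * a * h) * N by rewrite /th; ring.
  by rewrite lerDl !mulr_ge0 // ltW.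
have thE : th * qform S x = qform S x - h * (gam * B) * qform S x by rewrite /th; ring.
move: h1 h2 h3 h4 qw SYS E1; rewrite EE thE; set b := _ *+ 2; lra.
Qed.

(** Each step multiplies the lower bound by [1 - c h] and subtracts [O(h^2)]. Over [[0, T]] the
    factors leave at least [e = k0 * exp (- 2 c T)], and a fine mesh keeps the accumulated errors
    below [e / 2]. *)
Lemma ode_lower_bound T : pdmx Sigma0 -> 0 <= T ->
  exists2 k, 0 < k & forall t, 0 <= t <= T -> k%:M ⪯ Sigma t.
Proof.
move=> S0p T0; have [k0 k00 kS0] := pd_lower_bound S0p.
have [c [K [d [c0 K0 d0 step]]]] := ode_lower_step (pd_sym S0p) T0.
pose e := k0 * expR (- (2 * c * T)).
have e0 : 0 < e by rewrite mulr_gt0 // expR_gt0.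
exists (e / 2) => [|t /andP[t0 tT]]; first by rewrite divr_gt0.
have c2 : 0 <= 2 * c by rewrite mulr_ge0.
have KTe : 0 <= 2 * (K * T) / e by rewrite divr_ge0 ?(ltW e0) // !mulr_ge0.
have dV : 0 <= d^-1 by rewrite invr_ge0 ltW.
(* Gathers three demands on the mesh, all implied by [h * X <= 1]: [h <= d], [c * h <= 1/2] and
   [K * h * T <= e / 2]. *)
pose X := d^-1 + 2 * c + 2 * (K * T) / e.
have X0 : 0 < X.
  by rewrite /X -addrA ltr_pwDl ?invr_gt0 // addr_ge0.
pose N := Num.bound (T * X); have TXN : T * X < N%:R.
  by apply: archi_boundP; rewrite mulr_ge0 // ltW.
have N0 : 0 < N%:R :> R by apply: le_lt_trans TXN; rewrite mulr_ge0 // ltW.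
(* The grid is adapted to [t], which is its last point. *)
pose h := t / N%:R; have h0 : 0 <= h by rewrite divr_ge0 // ltW.
have tN : h * N%:R = t by rewrite divfK ?gt_eqF.
have hX : h * X <= 1.
  by rewrite /h mulrAC ler_pdivrMr // mul1r (le_trans _ (ltW TXN)) // ler_wpM2r // ltW.
have hE : t / N%:R = h by [].
clearbody h; have hd : h * d^-1 <= 1.
  by rewrite (le_trans _ hX) // ler_wpM2l // /X -addrA lerDl addr_ge0.
have {}hd : h <= d by move: hd; rewrite ler_pdivrMr // mul1r.
have hc : c * h <= 2^-1.
  have : h * (2 * c) <= 1.
    rewrite (le_trans _ hX) // ler_wpM2l // /X.
    lra.
  lra.
have hK : K * h * T <= e / 2.
  have : h * (2 * (K * T) / e) <= 1.
    rewrite (le_trans _ hX) // ler_wpM2l // /X.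
    lra.
  rewrite mulrA ler_pdivrMr // mul1r; lra.
pose f i := k0 * expR (- (2 * (c * h)) * i%:R) - K * h ^+ 2 * i%:R.
have fe i : (i <= N)%N -> e / 2 <= f i.
  move=> iN; have iT : h * i%:R <= T.
    by apply: le_trans tT; rewrite -tN ler_wpM2l // ler_nat.
  have : e <= k0 * expR (- (2 * (c * h)) * i%:R).
    by rewrite /e ler_pM2l // ler_expR mulNr lerN2 -!mulrA ler_wpM2l // ler_wpM2l //.
  have : K * h ^+ 2 * i%:R <= K * h * T.
    by rewrite expr2 mulrA -mulrA ler_wpM2l // mulr_ge0.
  rewrite /f; lra.
suff : forall i, (i <= N)%N -> (f i)%:M ⪯ Sigma (h * i%:R).
  move=> /(_ N (leqnn N)); rewrite tN; apply: loewner_trans.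
  exact/loewner_scalar/fe.
elim=> [_|i IHi iN].
  by rewrite mulr0 ode_initial /f !mulr0 expR0 mulr1 subr0.
have [i1 i2 i3] := grid_point t0 iN; rewrite hE in i1 i2 i3.
have fi0 : 0 <= f i by rewrite (le_trans _ (fe i (ltnW iN))) // divr_ge0 // ltW.
have := step _ _ i1 (le_trans i2 tT); rewrite i3 => /(_ hd _ fi0 (IHi (ltnW iN))).
apply: loewner_trans; apply: loewner_scalar.
have ch : 0 <= c * h <= 2^-1 by rewrite hc mulr_ge0.
have := expRN_double_le ch; set q := expR _ => qc.
have -> : f i.+1 = k0 * expR (- (2 * (c * h)) * i%:R) * q - K * h ^+ 2 * i%:R - K * h ^+ 2.
  by rewrite /f -[i.+1%:R]natr1 (mulrDr (- _)) mulr1 expRD /q; ring.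
have hh : k0 * expR (- (2 * (c * h)) * i%:R) * q <= k0 * expR (- (2 * (c * h)) * i%:R) * (1 - c * h).
  by rewrite ler_wpM2l // mulr_ge0 ?expR_ge0 // ltW.
have hk : 0 <= K * h ^+ 2 * i%:R * (c * h).
  by rewrite !mulr_ge0 // sqr_ge0.
rewrite /f; lra.
Qed.

(** * The inverse covariance and its time average *)

Definition info_rate (P : 'M[R]_n) := P *m A + A^T *m P + P *m W *m P.

(** Conjugation by [P = S^-1] turns the Euler increment of [Sigma] into [- Y] plus [h] times
    [info_rate P], so the control now enters additively. Replacing [P - P'] by [P (S' - S) P] costs
    [P' (S' - S) P (S' - S) P], which is quadratic in the step. *)
Lemma inverse_euler T : pdmx Sigma0 -> 0 <= T -> exists2 K, 0 <= K &
  forall s t, 0 <= s <= t -> t <= T ->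
  mx_norm1 (invmx (Sigma t) - invmx (Sigma s)
    + ((t - s) *: info_rate (invmx (Sigma s)) - info_increment s t)) <= K * (t - s) ^+ 2.
Proof.
move=> S0p T0; have [k k0 kS] := ode_lower_bound S0p T0.
have [K1 K10 SK] := ode_euler T0; have [L L0 SL] := ode_lipschitz T0.
pose p := k^-1 *+ n *+ n.
have p0 : 0 <= p by rewrite !mulrn_wge0 // invr_ge0 ltW.
have Pp t : 0 <= t <= T -> mx_norm1 (invmx (Sigma t)) <= p.
  by move=> tT; apply: invmx_bound => //; exact: kS.
exists (p * p * p * (L * L) + p * K1 * p) => [|s t st tT].
  by rewrite addr_ge0 ?mulr_ge0.
have /andP[s0 le_st] := st; have t0 := le_trans s0 le_st.
have tI : 0 <= t <= T by rewrite t0.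
have sI : 0 <= s <= T by rewrite s0 (le_trans le_st).
have h0 : 0 <= t - s by rewrite subr_ge0.
have uS : Sigma s \in unitmx by exact: pd_unit (pd_of_lower_bound k0 (kS s sI)).
have uT : Sigma t \in unitmx by exact: pd_unit (pd_of_lower_bound k0 (kS t tI)).
have := Pp s sI; have := Pp t tI; have := SK s t st tT; have := SL s t st tT.
set S := Sigma s in uS *; set S' := Sigma t in uT *; set h := t - s in h0 *.
set P := invmx S; set P' := invmx S'; set Y := info_increment s t.
set E := S' - S - _ => SSL EK P'p PP.
have PE : P *m E *m P = P *m (S' - S) *m P - (h *: info_rate P - Y).
  rewrite /E mulmxBr mulmxBl; congr (_ - _); rewrite mulmxBr mulmxBl; congr (_ - _).
    rewrite -scalemxAr -scalemxAl /drift !mulmxDr !mulmxDl /info_rate; congr (_ *: (_ + _ + _)).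
      by rewrite -!mulmxA mulmxV // mulmx1.
    by rewrite !mulmxA mulVmx // mul1mx.
  by rewrite !mulmxA mulVmx // mul1mx -mulmxA mulmxV // mulmx1.
have PP' : P' *m (S' - S) *m P = P - P'.
  by rewrite mulmxBr mulmxBl mulVmx // mul1mx -mulmxA mulmxV // mulmx1.
have -> : P' - P + (h *: info_rate P - Y) = P' *m (S' - S) *m P *m (S' - S) *m P - P *m E *m P.
  rewrite PE PP' -mulmxA mulmxBl (mulmxA P) (mulmxA P') PP'.
  move: (P *m _ *m P) (h *: _) => M1 M2; apply/matrixP => x y; rewrite !mxE; ring.
rewrite (le_trans (mx_norm1B _ _)) // mulrDl; apply: lerD.
  have -> : p * p * p * (L * L) * h ^+ 2 = p * (L * h) * p * (L * h) * p by ring.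
  do 4 (rewrite (le_trans (mx_norm1M _ _)) // ler_pM ?mx_norm1_ge0 //).
rewrite (_ : p * K1 * p * h ^+ 2 = p * (K1 * h ^+ 2) * p); last by ring.
by do 2 (rewrite (le_trans (mx_norm1M _ _)) // ler_pM ?mx_norm1_ge0 //).
Qed.

Lemma info_increment_sum tau N : (0 < N)%N -> 0 <= tau ->
  \sum_(k < N) info_increment (tau / N%:R * k%:R) (tau / N%:R * k.+1%:R) =
  \sum_j use_time j tau *: G j.
Proof.
move=> N0 tau0; have Nn : 0 < N%:R :> R by rewrite ltr0n.
rewrite /info_increment exchange_big; apply: eq_bigr => j _ /=.
rewrite -scaler_suml -(big_mkord xpredT (fun k => use_time j (tau / N%:R * k.+1%:R)
  - use_time j (tau / N%:R * k%:R))) telescope_sumr // mulr0 divfK ?gt_eqF //.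
by rewrite {2}/use_time primitive0 subr0.
Qed.

Lemma trace_cost_integrable (T : 'M[R]_n) :
  integrable_half_line (fun t => \tr (T *m Sigma t)).
Proof.
apply: (@eq_integrable_half_line _ (fun t => \sum_a \sum_b T a b * Sigma t b a)).
  by move=> t _; apply: eq_bigr => a _; rewrite mxE.
apply: integrable_half_line_sum => a _; apply: integrable_half_line_sum => b _.
exact/integrable_half_lineZ/ode_entry_integrable.
Qed.

(* [Q] is the average of [Sigma^-1] over a fine grid of [[0, tau]]. *)
Lemma average_certificate (T : 'M[R]_n) : psdmx T -> pdmx Sigma0 ->
  forall e : R, 0 < e -> exists tau0 : R, forall tau, tau0 <= tau -> 0 < tau ->
  exists Q, [/\ pdmx Q,
    Q *m A + A^T *m Q + Q *m W *m Q - \sum_j (use_time j tau / tau) *: G j ⪯ e%:M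
  & \tr (T *m invmx Q) <= primitive (fun t => \tr (T *m Sigma t)) tau / tau + e].
Proof.
move=> Tp S0p e e0; pose b := mx_norm1 (invmx Sigma0).
have b0 : 0 <= b by exact: mx_norm1_ge0.
(* Makes the boundary term [b / tau] at most [e / 2]; the other half of [e] is for the Euler
   errors. *)
exists (2 * b / e) => tau le_tau tau0; have tau0' := ltW tau0.
have [K K0 PK] := inverse_euler S0p tau0'; have [L L0 SL] := ode_lipschitz tau0'.
have [kap kap0 kapS] := ode_lower_bound S0p tau0'.
have T0 := mx_norm1_ge0 T.
(* [K] and [L] depend on [tau], so the mesh is chosen after it: fine enough for the Euler errors and
   for the Riemann sum of the cost. *)
pose X := tau * (2 * K + mx_norm1 T * L) / e.
have X0 : 0 <= X by rewrite divr_ge0 ?(ltW e0) // mulr_ge0 // addr_ge0 // mulr_ge0.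
pose N := (Num.bound X).+1.
have XN : X <= N%:R by rewrite (le_trans (ltW (archi_boundP X0))) // ler_nat.
have N0 : 0 < N%:R :> R by rewrite ltr0n.
pose h := tau / N%:R; have h0 : 0 < h by rewrite divr_gt0.
have hN : h * N%:R = tau by rewrite divfK ?gt_eqF.
have hX : h * (2 * K + mx_norm1 T * L) <= e.
  by rewrite /h mulrAC ler_pdivrMr // mulrC [e * _]mulrC -ler_pdivrMr // mulrC.
have hK : 2 * (K * h) <= e.
  by have := mulr_ge0 (ltW h0) (mulr_ge0 T0 L0); lra.
have hL : mx_norm1 T * L * h <= e.
  by have := mulr_ge0 (ltW h0) K0; lra.
have hE : tau / N%:R = h by [].
clearbody h.
pose P k := invmx (Sigma (h * k%:R)).
have grid k : (k < N)%N -> [/\ 0 <= h * k%:R <= h * k.+1%:R, h * k.+1%:R <= tau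
    & h * k.+1%:R - h * k%:R = h].
  by move=> kN; have := grid_point tau0' kN; rewrite hE.
have Sp k : (k <= N)%N -> pdmx (Sigma (h * k%:R)).
  move=> kN; apply: pd_of_lower_bound kap0 (kapS _ _).
  by rewrite mulr_ge0 ?(ltW h0) //= -hN ler_wpM2l ?(ltW h0) // ler_nat.
have Pp k : (k <= N)%N -> pdmx (P k) by move=> kN; exact/pd_inv/Sp.
pose w (k : 'I_N) : R := N%:R^-1.
have w0 k : 0 <= w k by rewrite invr_ge0 ltW.
have w1 : \sum_k w k = 1.
  by rewrite sumr_const card_ord -[LHS]mulr_natr mulVf // gt_eqF.
pose Q := \sum_(k < N) w k *: P k.
have Qp : pdmx Q.
  rewrite /Q (bigD1 ord0) //= addrC; apply: psd_pdD.
    by apply: psd_sum => k _; apply: psdZ => //; exact/pd_psd/Pp/ltnW.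
  by apply: pdZ; [rewrite invr_gt0|exact: Pp].
exists Q; split => //.
- pose Er k := P k.+1 - P k + (h *: info_rate (P k)
    - info_increment (h * k%:R) (h * k.+1%:R)).
  have ErK k : (k < N)%N -> mx_norm1 (Er k) <= K * h ^+ 2.
    by move=> kN; have [k1 k2 k3] := grid k kN; have := PK _ _ k1 k2; rewrite k3.
  have sW := psd_sym W_psd; have sQ := pd_sym Qp.
  apply: loewner_leP => [||x]; last first.
  + rewrite qform_scalar; set M := qform 1%:M x; have M0 : 0 <= M by exact: qform1_ge0.
    have QWQ : qform (Q *m W *m Q) x <= qform (\sum_k w k *: (P k *m W *m P k)) x.
      apply: loewner_qform; apply: congr_Jensen => // k.
      exact/pd_sym/Pp/ltnW.
    have QA : Q *m A + A^T *m Q = \sum_k w k *: (P k *m A + A^T *m P k).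
      rewrite /Q mulmx_suml mulmx_sumr -big_split; apply: eq_bigr => k _ /=.
      by rewrite -scalemxAl -scalemxAr scalerDr.
    rewrite qformB qformD QA.
    have rateE : qform (\sum_k w k *: (P k *m A + A^T *m P k)) x +
        qform (\sum_k w k *: (P k *m W *m P k)) x =
        N%:R^-1 * \sum_(k < N) qform (info_rate (P k)) x.
      rewrite !qform_sum -big_split mulr_sumr; apply: eq_bigr => k _ /=.
      by rewrite !qformZ /info_rate [in RHS]qformD mulrDr.
    have infoE : \sum_j (use_time j tau / tau) *: G j =
        tau^-1 *: \sum_(k < N) info_increment (h * k%:R) (h * k.+1%:R).
      rewrite -hE info_increment_sum // scaler_sumr; apply: eq_bigr => j _.
      by rewrite scalerA mulrC.
    (* The increments of [P] telescope. Of the two end terms, the final one is nonpositive and is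
       discarded below. *)
    have sumE : h * \sum_(k < N) qform (info_rate (P k)) x -
        qform (\sum_(k < N) info_increment (h * k%:R) (h * k.+1%:R)) x =
        qform (P 0%N) x - qform (P N) x + \sum_(k < N) qform (Er k) x.
      have tel : qform (P 0%N) x - qform (P N) x + \sum_(k < N) (qform (P k.+1) x - qform (P k) x) = 0.
        rewrite -(big_mkord xpredT (fun k => qform (P k.+1) x - qform (P k) x)).
        by rewrite telescope_sumr //; ring.
      rewrite [in RHS](eq_bigr (fun k : 'I_N => (qform (P k.+1) x - qform (P k) x) +
        (h * qform (info_rate (P k)) x - qform (info_increment (h * k%:R) (h * k.+1%:R)) x))); last first.
        by move=> k _; rewrite /Er qformD !qformB qformZ.
      by rewrite big_split /= addrA tel add0r sumrB -mulr_sumr qform_sum.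
    have ErN : \sum_(k < N) qform (Er k) x <= N%:R * (K * h ^+ 2 * M).
      rewrite -[X in X%:R * _](card_ord N) mulr_natl -sumr_const; apply: ler_sum => k _.
      rewrite (le_trans (le_trans (ler_norm _) (qform_le_norm1 _ _))) //.
      by rewrite ler_wpM2r // ErK.
    have P0b : qform (P 0%N) x <= b * M.
      rewrite /P mulr0 ode_initial.
      by rewrite (le_trans (le_trans (ler_norm _) (qform_le_norm1 _ _))).
    have PN0 : 0 <= qform (P N) x by exact/psd_qform/pd_psd/Pp.
    rewrite infoE qformZ.
    set Yx := qform (\sum_(k < N) _) x in sumE *.
    set rx := \sum_(k < N) _ in sumE rateE.
    have NV : N%:R^-1 = h / tau by rewrite -hN invfM mulrA mulfV ?mul1r // gt_eqF.
    rewrite NV in rateE.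
    have bd : tau^-1 * (h * rx - Yx) <= e * M.
      rewrite mulrC ler_pdivrMr // sumE.
      have bt : 2 * b * M <= tau * e * M.
        by rewrite ler_wpM2r // -ler_pdivrMr.
      have Kt : 2 * (N%:R * (K * h ^+ 2 * M)) <= e * tau * M.
        have -> : 2 * (N%:R * (K * h ^+ 2 * M)) = 2 * (K * h) * (h * N%:R) * M by ring.
        by rewrite hN ler_wpM2r // ler_wpM2r.
      lra.
    have : h / tau * rx - tau^-1 * Yx = tau^-1 * (h * rx - Yx) by ring.
    lra.
  + by rewrite tr_scalar_mx.
  + rewrite linearB !linearD /= !trmx_mul trmxK sQ sW.
    rewrite [_ + A^T *m _]addrC !mulmxA; congr (_ - _).
    rewrite linear_sum; apply: eq_bigr => j _.
    by rewrite linearZ /= psd_sym.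
- have QS : invmx Q ⪯ \sum_k w k *: invmx (P k).
    by apply: invmx_Jensen => // k; exact/Pp/ltnW.
  apply: (le_trans (loewner_tr Tp QS)).
  have -> : \tr (T *m \sum_k w k *: invmx (P k)) =
      N%:R^-1 * \sum_(k < N) \tr (T *m Sigma (h * k%:R)).
    rewrite mulmx_sumr linear_sum mulr_sumr; apply: eq_bigr => k _ /=.
    by rewrite -scalemxAr linearZ /= /P invmxK.
  set f := fun t => \tr (T *m Sigma t).
  (* Left Riemann sums: the integrand is Lipschitz with constant [mx_norm1 T * L], so after division
     by [tau] the total error is at most [mx_norm1 T * L * h <= e]. *)
  have step k : (k < N)%N -> `|primitive f (h * k.+1%:R) - primitive f (h * k%:R)
      - h * f (h * k%:R)| <= mx_norm1 T * L * h * h.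
    move=> kN; have [k1 k2 k3] := grid k kN; have /andP[k0 k0'] := k1.
    have := primitive_close (K := mx_norm1 T * L * h) (trace_cost_integrable T)
      (integrable_half_line_cst (f (h * k%:R))) k1.
    rewrite !primitive_cst ?(le_trans k0) // -mulrBr k3 mulrC; rewrite mulrC => step.
    rewrite [h * f _]mulrC; apply: step => r /andP[kr rk].
    rewrite /f -linearB -mulmxBr (le_trans (tr_le_norm1 _)) // (le_trans (mx_norm1M _ _)) //.
    rewrite -mulrA ler_wpM2l // (le_trans (SL (h * k%:R) r _ _)) ?k0 //.
      exact: le_trans k2.
    by rewrite ler_wpM2l //; lra.
  have tel : primitive f tau = \sum_(k < N) (primitive f (h * k.+1%:R) - primitive f (h * k%:R)).
    rewrite -(big_mkord xpredT (fun k => primitive f (h * k.+1%:R) - primitive f (h * k%:R))).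
    by rewrite telescope_sumr // hN mulr0 primitive0 subr0.
  have bd : h * (\sum_(k < N) f (h * k%:R)) <= primitive f tau + N%:R * (mx_norm1 T * L * h * h).
    rewrite tel -[X in X%:R * _](card_ord N) mulr_natl -sumr_const -big_split mulr_sumr /=.
    apply: ler_sum => k _; have := step k (ltn_ord k); rewrite ler_norml => /andP[+ _]; lra.
  have NV : N%:R^-1 = h / tau by rewrite -hN invfM mulrA mulfV ?mul1r // gt_eqF.
  rewrite NV mulrAC ler_pdivrMr // mulrDl divfK ?gt_eqF // (le_trans bd) // lerD2l.
  have -> : N%:R * (mx_norm1 T * L * h * h) = mx_norm1 T * L * h * (h * N%:R) by ring.
  by rewrite hN ler_wpM2r.
Qed.

End RiccatiFlow.

(** * The lower bound *)

Section Schedules.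
Context {R : realType}.
Implicit Types (n : nat).

(** Joint convexity of the program: the Jensen inequalities over a two-point index set, here
    [bool]. *)
Lemma riccati_mix n (A W T H H0 Q Q0 : 'M[R]_n) (a b d : R) : 0 <= d <= 1 ->
  psdmx W -> psdmx T -> pdmx Q -> pdmx Q0 ->
  Q *m A + A^T *m Q + Q *m W *m Q - H ⪯ a%:M ->
  Q0 *m A + A^T *m Q0 + Q0 *m W *m Q0 - H0 ⪯ b%:M ->
  let Q' := (1 - d) *: Q + d *: Q0 in
  [/\ pdmx Q',
      Q' *m A + A^T *m Q' + Q' *m W *m Q' - ((1 - d) *: H + d *: H0)
        ⪯ ((1 - d) * a + d * b)%:M
    & \tr (T *m invmx Q') <= (1 - d) * \tr (T *m invmx Q) + d * \tr (T *m invmx Q0)].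
Proof.
move=> /andP[d0 d1] Wp Tp Qp Q0p HQ HQ0 Q'.
pose w (c : bool) := if c then 1 - d else d.
pose P (c : bool) := if c then Q else Q0.
have w0 c : 0 <= w c by rewrite /w; case: c; rewrite ?subr_ge0.
have w1 : \sum_c w c = 1 by rewrite big_bool /= subrK.
have Pp c : pdmx (P c) by case: c.
have QE : \sum_c w c *: P c = Q' by rewrite big_bool.
have Q'p : pdmx Q'.
  have [dE|d0'] := eqVneq d 0.
    by rewrite /Q' dE subr0 scale1r scale0r addr0.
  rewrite /Q'; apply: psd_pdD; first by apply: psdZ; rewrite ?subr_ge0 //; exact: pd_psd.
  by apply: pdZ => //; rewrite lt_neqAle eq_sym d0'.
split => //.
- have := congr_Jensen w0 w1 Wp (fun c => pd_sym (Pp c)).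
  rewrite QE big_bool /= => HJ.
  have := psdD (psdD (psdZ d0 HQ0) (psdZ (c := 1 - d) _ HQ)) HJ.
  rewrite subr_ge0 => /(_ d1); rewrite /loewner_le; congr psdmx.
  have -> : Q' *m A + A^T *m Q' =
      (1 - d) *: (Q *m A + A^T *m Q) + d *: (Q0 *m A + A^T *m Q0).
    rewrite /Q' mulmxDl mulmxDr -!scalemxAl -!scalemxAr !scalerDr.
    by rewrite addrACA.
  move: (_ + A^T *m Q) (Q *m W *m Q) (_ + A^T *m Q0) (Q0 *m W *m Q0) (Q' *m W *m Q').
  move=> M1 M2 M3 M4 M5; apply/matrixP => x y; rewrite !mxE.
  by case: (x == y); rewrite ?mulr1n ?mulr0n; ring.
- have := invmx_Jensen w0 w1 Pp; rewrite QE big_bool /= => /(_ Q'p) /(loewner_tr Tp).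
  by rewrite mulmxDr -!scalemxAr linearD !linearZ.
Qed.

Lemma primitive_le (f g : R -> R) t : 0 <= t -> integrable_half_line f ->
  integrable_half_line g -> (forall r, 0 <= r -> f r <= g r) ->
  primitive f t <= primitive g t.
Proof.
move=> t0 fi gi fg; apply: le_Rintegral => //; [exact: fi|exact: gi|].
by move=> r /=; rewrite in_itv /= => /andP[r0 _]; exact: fg.
Qed.

Lemma use_time_sum (I : finType) (b : I -> R -> bool) t : 0 < t ->
  (forall i, measurable_fun (`[0, +oo[ : set (measurableTypeR R)) (b i)) ->
  (forall r, 0 <= r -> (\sum_i b i r <= 1)%N) ->
  \sum_i primitive (fun r => (b i r)%:R) t / t <= 1.
Proof.
move=> t0 mb b1; rewrite -mulr_suml ler_pdivrMr // mul1r.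
have bi i : integrable_half_line (fun r => (b i r)%:R) := integrable_half_line_indicator (mb i).
have t0' := ltW t0; rewrite -primitive_sum //.
rewrite -[X in _ <= X]mul1r -(primitive_cst 1 t0'); apply: primitive_le => //.
- by apply: integrable_half_line_sum.
- exact: integrable_half_line_cst.
by move=> r r0; rewrite -natr_sum lern1 b1.
Qed.

Context (N M : nat) (n : 'I_N -> nat) (q : 'I_N -> 'I_M -> nat)
  (A W T : forall i : 'I_N, 'M[R]_(n i))
  (C : forall (i : 'I_N) (j : 'I_M), 'M[R]_(q i j, n i))
  (V : forall (i : 'I_N) (j : 'I_M), 'M[R]_(q i j))
  (kappa : 'I_N -> 'I_M -> R)
  (Sigma0 : forall i : 'I_N, 'M[R]_(n i)).
Context (W_psd : forall i, psdmx (W i)) (T_psd : forall i, psdmx (T i))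
  (V_pd : forall i j, pdmx (V i j)) (Sigma0_pd : forall i, pdmx (Sigma0 i))
  (AC_detectable : forall i, exists (m : nat) (js : 'I_m -> 'I_M),
     detectable (A i) (stacked_output C i js)).

Let info i j := info_mx (C i j) (V i j).
Let cost (Q : forall i, 'M[R]_(n i)) p :=
  \sum_(i < N) (\tr (T i *m invmx (Q i)) + \sum_(j < M) kappa i j * p i j).
Let Z := riccati_value A W T C V kappa.

Lemma info_mx_psd i j : psdmx (info i j).
Proof. by apply: psd_congr; exact/pd_psd/pd_inv. Qed.

Lemma riccati_value_le Q p : riccati_feasible A W C V Q p -> (Z <= (cost Q p)%:E)%E.
Proof. by move=> Qp; apply: ereal_inf_lbound; exists Q, p. Qed.

Lemma schedule_strict : exists (Q0 : forall i, 'M[R]_(n i)) (p0 : 'I_N -> 'I_M -> R) eta,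
  [/\ schedule_constraints p0, 0 < eta & forall i, pdmx (Q0 i) /\
    Q0 i *m A i + (A i)^T *m Q0 i + Q0 i *m W i *m Q0 i - \sum_j p0 i j *: info i j
      ⪯ (- eta)%:M].
Proof.
(* Small enough that both [N * c] and [M * c] are at most 1, as the sums over systems and over
   sensors require. *)
pose c : R := (N + M).+1%:R^-1; have c0 : 0 < c by rewrite invr_gt0 ltr0n.
have ex i : exists Q : 'M[R]_(n i), exists eta, [/\ pdmx Q, 0 < eta &
    Q *m A i + (A i)^T *m Q + Q *m W i *m Q - \sum_j c *: info i j ⪯ (- eta)%:M].
  have [m [js det]] := AC_detectable i.
  exact: detectable_strict_riccati (W_psd i) (V_pd i) det c0.
pose Q0 i := projT1 (cid (ex i)).
pose eta i := projT1 (cid (projT2 (cid (ex i)))).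
have Q0P i : [/\ pdmx (Q0 i), 0 < eta i & Q0 i *m A i + (A i)^T *m Q0 i
    + Q0 i *m W i *m Q0 i - \sum_j c *: info i j ⪯ (- eta i)%:M].
  exact: projT2 (cid (projT2 (cid (ex i)))).
have [e e0 eP] : exists2 e : R, 0 < e & forall i, e <= eta i.
  by apply: finite_pos_lower_bound => i; case: (Q0P i).
have csum k : (k <= N + M)%N -> \sum_(i < k) c <= 1.
  move=> kNM; rewrite sumr_const card_ord -(mulr_natl c) /c ler_pdivrMr ?ltr0n // mul1r.
  by rewrite ler_nat ltnW.
exists Q0, (fun _ _ => c), e; split => //.
  split => [i j|j|i].
  - by rewrite (ltW c0) /= invf_le1 ?ltr0n // ler1n.
  - by apply: csum; rewrite leq_addr.
  - by apply: csum; rewrite leq_addl.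
move=> i; case: (Q0P i) => Q0p _ h; split => //; apply: loewner_trans h _.
by apply: loewner_scalar; rewrite lerN2.
Qed.

Context (pi : 'I_N -> 'I_M -> R -> bool) (Sigma : forall i : 'I_N, R -> 'M[R]_(n i)).
Context (pi_adm : admissible pi)
  (Sigma_cov : error_covariance A W C V Sigma0 pi Sigma).

Let Sigma_ode i :
  ode_solution (riccati_rhs (A i) (W i) (info i) (pi i)) (Sigma0 i) (Sigma i).
Proof. exact: Sigma_cov. Qed.

Let running t := \sum_(i < N) (\tr (T i *m Sigma i t) + \sum_(j < M) kappa i j * (pi i j t)%:R).

Lemma running_cost_integrable : integrable_half_line running.
Proof.
have [mpi _ _] := pi_adm.
apply: integrable_half_line_sum => i _; apply: integrable_half_lineD.
  exact: trace_cost_integrable (@Sigma_ode i) (T i).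
apply: integrable_half_line_sum => j _; apply: integrable_half_lineZ.
exact: integrable_half_line_indicator.
Qed.

Lemma primitive_running_cost t : 0 <= t -> primitive running t =
  \sum_(i < N) (primitive (fun r => \tr (T i *m Sigma i r)) t
    + \sum_(j < M) kappa i j * use_time (pi i) j t).
Proof.
move=> t0; have [mpi _ _] := pi_adm.
have pii i j : integrable_half_line (fun r => (pi i j r)%:R) := integrable_half_line_indicator (mpi i j).
have Ti i : integrable_half_line (fun r => \tr (T i *m Sigma i r)).
  exact: trace_cost_integrable (@Sigma_ode i) (T i).
have ki i : integrable_half_line (fun r => \sum_(j < M) kappa i j * (pi i j r)%:R).
  by apply: integrable_half_line_sum => j _; exact: integrable_half_lineZ.
rewrite primitive_sum //; last by move=> i; exact: integrable_half_lineD.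
apply: eq_bigr => i _; rewrite primitiveD //; congr (_ + _).
rewrite primitive_sum //; last by move=> j; exact: integrable_half_lineZ.
by apply: eq_bigr => j _; rewrite primitiveZ.
Qed.

(** [J0] is the cost of the strictly feasible point. It does not depend on [d], so [d] can tend to
    zero afterwards, and the first conjunct excludes the value [+oo]. *)
Lemma riccati_value_le_average : exists J0 : R, (Z <= J0%:E)%E /\
  forall d, 0 < d <= 1 -> exists tau0, forall tau, tau0 <= tau -> 0 < tau ->
  (Z <= ((1 - d) * (primitive running tau / tau + d) + d * J0)%:E)%E.
Proof.
have [mpi pi_sensor pi_system] := pi_adm.
have [Q0 [p0 [eta [p0c eta0 Q0P]]]] := schedule_strict.
exists (cost Q0 p0); split.
  apply: riccati_value_le; split => // i; case: (Q0P i) => Q0p h.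
  split; last by rewrite loewner_lt0.
  apply: loewner_trans h _; rewrite -[X in _ ⪯ X](raddf0 (@scalar_mx R (n i))).
  by apply: loewner_scalar; rewrite oppr_le0 ltW.
(* The first bound lets the share [d] of the margin [eta] absorb a violation [e] of the constraints;
   the second keeps the excess cost, [e] for each of the [N] systems, below [d]. *)
move=> d /andP[d0 d1]; pose e := Num.min (d * eta) (d / N.+1%:R).
have e0 : 0 < e by rewrite lt_min mulr_gt0 // divr_gt0 // ltr0n.
have ed : e <= d * eta by rewrite ge_min lexx.
have eN : N%:R * e <= d.
  apply: (@le_trans _ _ (N%:R * (d / N.+1%:R))).
    by rewrite ler_wpM2l // ge_min lexx orbT.
  by rewrite mulrA ler_pdivrMr ?ltr0n // mulrC ler_pM2l // ler_nat.
have cert i := average_certificate (W_psd i) (info_mx_psd i) (mpi i) (@Sigma_ode i)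
  (T_psd i) (Sigma0_pd i) e0.
pose tau0 i := projT1 (cid (cert i)).
exists (\sum_i `|tau0 i|) => tau le_tau tau_gt0.
have cert' i : exists Q : 'M[R]_(n i), [/\ pdmx Q,
    Q *m A i + (A i)^T *m Q + Q *m W i *m Q
      - \sum_j (use_time (pi i) j tau / tau) *: info i j ⪯ e%:M
  & \tr (T i *m invmx Q) <= primitive (fun t => \tr (T i *m Sigma i t)) tau / tau + e].
  apply: (projT2 (cid (cert i))) => //; apply: le_trans le_tau.
  by rewrite (bigD1 i) //= (le_trans (ler_norm _)) // lerDl sumr_ge0.
pose Q i := projT1 (cid (cert' i)).
pose p i j := use_time (pi i) j tau / tau.
have d01 : 0 <= d <= 1 by rewrite ltW.
have QP i := projT2 (cid (cert' i)).
pose Q' i := (1 - d) *: Q i + d *: Q0 i.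
pose p' i j := (1 - d) * p i j + d * p0 i j.
have Q'P i : [/\ pdmx (Q' i), Q' i *m A i + (A i)^T *m Q' i + Q' i *m W i *m Q' i -
      \sum_j p' i j *: info i j ⪯ 0 & \tr (T i *m invmx (Q' i)) <=
      (1 - d) * \tr (T i *m invmx (Q i)) + d * \tr (T i *m invmx (Q0 i))].
  have [Qp QR _] := QP i; have [Q0p Q0R] := Q0P i.
  have [m1 m2 m3] := riccati_mix d01 (W_psd i) (T_psd i) Qp Q0p QR Q0R; split => //.
  have -> : \sum_j p' i j *: info i j = (1 - d) *: (\sum_j p i j *: info i j) +
      d *: (\sum_j p0 i j *: info i j).
    rewrite !scaler_sumr -big_split; apply: eq_bigr => j _ /=.
    by rewrite !scalerA -scalerDl.
  apply: loewner_trans m2 _; rewrite -[X in _ ⪯ X](raddf0 (@scalar_mx R (n i))).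
  apply: loewner_scalar; have : 0 <= d * e by rewrite mulr_ge0 ?ltW.
  lra.
have d1' : 0 <= 1 - d by rewrite subr_ge0.
have mixle a b : a <= 1 -> b <= 1 -> (1 - d) * a + d * b <= 1.
  move=> a1 b1; have : (1 - d) * a <= (1 - d) * 1 by rewrite ler_wpM2l.
  have : d * b <= d * 1 by rewrite ler_pM2l.
  lra.
have [p0c1 p0c2 p0c3] := p0c.
have p'c : schedule_constraints p'.
  split => [i j|j|i].
  - have /andP[p00 p01] := p0c1 i j.
    have := use_time_increment (mpi i) j (s := 0) (t := tau).
    rewrite lexx ltW // => /(_ isT); rewrite {2 4}/use_time primitive0 !subr0 => /andP[u0 u1].
    have pp0 : 0 <= p i j by rewrite divr_ge0 // ltW.
    have pp1 : p i j <= 1 by rewrite ler_pdivrMr // mul1r.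
    by rewrite mixle // addr_ge0 // mulr_ge0 // ltW.
  - rewrite big_split -!mulr_sumr /= mixle //.
    by apply: (use_time_sum tau_gt0 (fun i => mpi i j)) => r r0; exact: pi_sensor.
  - rewrite big_split -!mulr_sumr /= mixle //.
    by apply: (use_time_sum tau_gt0 (mpi i)) => r r0; exact: pi_system.
have feas : riccati_feasible A W C V Q' p'.
  split => // i; case: (Q'P i) => Q'p Q'R _; split => //.
  by rewrite loewner_lt0.
apply: (le_trans (riccati_value_le feas)); rewrite lee_fin.
have costQ' : cost Q' p' <= (1 - d) * cost Q p + d * cost Q0 p0.
  rewrite /cost !mulr_sumr -big_split; apply: ler_sum => i _ /=.
  have [_ _ h] := Q'P i.
  have -> : \sum_j kappa i j * p' i j =
      (1 - d) * (\sum_j kappa i j * p i j) + d * (\sum_j kappa i j * p0 i j).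
    by rewrite !mulr_sumr -big_split; apply: eq_bigr => j _ /=; rewrite /p'; ring.
  lra.
apply: (le_trans costQ'); rewrite lerD2r ler_wpM2l //.
have -> : primitive running tau / tau = \sum_(i < N)
    (primitive (fun t => \tr (T i *m Sigma i t)) tau / tau + \sum_(j < M) kappa i j * p i j).
  rewrite primitive_running_cost ?ltW // mulr_suml; apply: eq_bigr => i _.
  rewrite mulrDl; congr (_ + _); rewrite mulr_suml; apply: eq_bigr => j _.
  by rewrite mulrA.
apply: (@le_trans _ _ (\sum_(i < N) (primitive (fun t => \tr (T i *m Sigma i t)) tau / tau
  + \sum_(j < M) kappa i j * p i j) + N%:R * e)); last by rewrite lerD2l.
rewrite -[X in X%:R * e](card_ord N) mulr_natl -sumr_const -big_split; apply: ler_sum => i _ /=.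
have [_ _ h] := QP i; lra.
Qed.

Lemma riccati_value_le_average_cost : (Z <= average_cost T kappa pi Sigma)%E.
Proof.
have [J0 [ZJ0 ZJ]] := riccati_value_le_average.
pose J tau := primitive running tau / tau.
have JE tau : 0 < tau -> ((tau^-1)%:E * \int[@lebesgue_measure R]_(t in `[0%R, tau])
    (\sum_(i < N) (\tr (T i *m Sigma i t) + \sum_(j < M) kappa i j * (pi i j t)%:R))%:E)%E
    = (J tau)%:E.
  move=> tau0; have := integrable_fin_num _ (running_cost_integrable (ltW tau0)).
  move=> /(_ (measurable_itv _)) fin.
  by rewrite /J mulrC EFinM /primitive /Rintegral fineK.
(* The upper limit is an infimum over neighbourhoods [U] of infinity of suprema over [U]; it
   suffices to exhibit in each [U] one horizon [tau] with average cost at least [z - eps]. *)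
rewrite /average_cost limf_esupE; apply: le_ereal_inf_tmp => _ [U [B [_ BU]] <-].
move: ZJ0 ZJ; case: Z => [z||]; rewrite ?leNye // ?leye_eq // lee_fin => zJ0 zJ.
apply/lee_addgt0Pr => eps eps0.
(* The mixing loses at most [d * (J0 - z + 1) <= eps / 2], while [d <= 1/2] gives
   [(1 - d) * eps >= eps / 2]. *)
pose d := Num.min 2^-1 (eps / (2 * (J0 - z + 1))).
have den0 : 0 < J0 - z + 1 by rewrite ltr_wpDl // subr_ge0.
have d0 : 0 < d by rewrite lt_min invr_gt0 ltr0n divr_gt0 // mulr_gt0.
have d2 : d <= 2^-1 by rewrite ge_min lexx.
have deps : d * (2 * (J0 - z + 1)) <= eps.
  by rewrite -ler_pdivlMr ?mulr_gt0 // ge_min lexx orbT.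
have d1 : 0 < d <= 1 by rewrite d0; lra.
have [tau0 tauP] := zJ d d1.
pose tau := Num.max (B + 1) (Num.max tau0 1).
have tau_gt0 : 0 < tau by rewrite !lt_max ltr01 !orbT.
have tau_B : B < tau by rewrite lt_max ltrDl ltr01.
have tau_tau0 : tau0 <= tau by rewrite !le_max lexx orbT.
have := tauP tau tau_tau0 tau_gt0; rewrite lee_fin -/(J tau) => hz.
apply: (@le_trans _ _ ((J tau)%:E + eps%:E)%E).
  rewrite -EFinD lee_fin -subr_ge0.
  have : 0 <= (1 - d) * (J tau + eps - z) by nra.
  by rewrite pmulr_rge0 //; lra.
apply: leeD => //; apply: ereal_sup_ubound; exists tau; first exact: BU.
exact: JE.
Qed.

End Schedules.

(** * The semidefinite program *)

Section SchurComplement.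
Context {R : realType}.
Implicit Types n : nat.

Lemma qform_block n1 n2 (X : 'M[R]_n1) (Y : 'M[R]_(n1, n2)) (U : 'M[R]_n2)
    (x : 'cV[R]_n1) (y : 'cV[R]_n2) :
  qform (block_mx X Y Y^T U) (col_mx x y) =
  qform X x + (x^T *m Y *m y) 0 0 *+ 2 + qform U y.
Proof.
rewrite /qform tr_col_mx mul_row_block mul_row_col !mulmxDl !mx11D mulr2n.
suff -> : (y^T *m Y^T *m x) 0 0 = (x^T *m Y *m y) 0 0 by rewrite !addrA -!addrA (addrCA (qform _ _)).
by rewrite -[RHS]trmx11 !trmx_mul trmxK mulmxA.
Qed.

Lemma block_sym n1 n2 (X : 'M[R]_n1) (Y : 'M[R]_(n1, n2)) (U : 'M[R]_n2) :
  X^T = X -> U^T = U -> (block_mx X Y Y^T U)^T = block_mx X Y Y^T U.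
Proof. by move=> sX sU; rewrite tr_block_mx sX sU trmxK. Qed.

(** Two families of test vectors: [(0, y)] isolates [Q], and [(x, - Q^-1 x)], the minimiser in the
    second component, leaves [x^T (S - Q^-1) x]. *)
Lemma block_pd_inverse n (S Q : 'M[R]_n) : Q^T = Q ->
  pdmx (block_mx S 1%:M 1%:M Q) -> S^T = S -> pdmx Q /\ invmx Q ⪯ S.
Proof.
move=> sQ Bp sS.
have BE : block_mx S 1%:M 1%:M Q = block_mx S 1%:M (1%:M)^T Q by rewrite trmx1.
rewrite BE in Bp.
have Qp : pdmx Q.
  apply: pdP => // y y0; have := pd_qform (x := col_mx 0 y) Bp.
  rewrite col_mx_eq0 negb_and y0 orbT qform_block => /(_ isT).
  by rewrite trmx0 !mul0mx [in X in X *+ 2]mxE mul0rn /qform trmx0 !mul0mx [in X in X + 0]mxE addr0 add0r.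
split => //; have uQ := pd_unit Qp.
apply: loewner_leP => // [|x]; first exact: invmx_sym.
have := psd_qform (col_mx x ((- 1) *: (invmx Q *m x))) (pd_psd Bp).
rewrite qform_block qformZr qform_invmx // mulmx1 -scalemxAr [X in X *+ 2]mxE mulmxA.
rewrite -/(qform (invmx Q) x); lra.
Qed.

(** Completing the square gives [e |u|^2] plus the form of [Q] at [Q^-1 u + v]. For [e = 0] this
    vanishes on a nontrivial subspace when [n > 0], whence the perturbation. *)
Lemma inverse_block_pd n (Q : 'M[R]_n) e : pdmx Q -> 0 < e ->
  pdmx (block_mx (invmx Q + e%:M) 1%:M 1%:M Q).
Proof.
move=> Qp e0; have sQ := pd_sym Qp; have uQ := pd_unit Qp.
have sS : (invmx Q + e%:M)^T = invmx Q + e%:M.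
  by rewrite linearD /= tr_scalar_mx invmx_sym.
rewrite -[in X in block_mx _ _ X _]trmx1; apply: pdP => [|x]; first exact: block_sym.
rewrite -(vsubmxK x); set u := usubmx x; set v := dsubmx x => uv0.
rewrite qform_block qformD qform_scalar mulmx1.
have -> : qform (invmx Q) u + e * qform 1%:M u + (u^T *m v) 0 0 *+ 2 + qform Q v =
    e * qform 1%:M u + qform Q (invmx Q *m u + v).
  rewrite qform_cross // qform_invmx // trmx_mul invmx_sym // -(mulmxA u^T) mulVmx // mulmx1.
  by ring.
have [u0|u0] := eqVneq u 0; last first.
  by rewrite ltr_pwDl ?mulr_gt0 ?qform1_gt0 //; exact/psd_qform/pd_psd.
rewrite u0 mulmx0 add0r ltr_wpDl ?mulr_ge0 ?(ltW e0) ?qform1_ge0 //.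
by apply: pd_qform => //; move: uv0; rewrite u0 col_mx_eq0 eqxx.
Qed.

(** For fixed [u], the block form is concave in [v] with maximum at [v = W^(1/2) Q u], where its
    value is the form of [X + Q W Q] at [u]. *)
Lemma schur_nonpositive n (X Q W : 'M[R]_n) : X^T = X -> Q^T = Q -> psdmx W ->
  block_mx X (Q *m sqrtmx W) (sqrtmx W *m Q) (- 1%:M) ⪯ 0 <-> X + Q *m W *m Q ⪯ 0.
Proof.
move=> sX sQ Wp; have [Sp SS] := sqrtmxP Wp; set S := sqrtmx W in Sp SS *.
have sS := psd_sym Sp; have sW := psd_sym Wp.
have BE : block_mx X (Q *m S) (S *m Q) (- 1%:M) = block_mx X (Q *m S) (Q *m S)^T (- 1%:M).
  by rewrite trmx_mul sS sQ.
have sU : (- 1%:M : 'M[R]_n)^T = - 1%:M by rewrite linearN /= trmx1.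
have QWQ x : qform (Q *m W *m Q) x = qform 1%:M (S *m Q *m x).
  by rewrite -qform_congr mulmx1 trmx_mul sS sQ -SS !mulmxA.
have cross x y : (x^T *m (Q *m S) *m y) 0 0 = ((S *m Q *m x)^T *m 1%:M *m y) 0 0.
  by rewrite mulmx1 !trmx_mul sS sQ !mulmxA.
rewrite BE; split => h.
  apply: loewner_leP => [||x]; rewrite ?trmx0 //.
    by rewrite linearD /= sX !trmx_mul sQ sW mulmxA.
  have := loewner_qform (col_mx x (S *m Q *m x)) h.
  by rewrite qform_block cross !qform0 qformD QWQ qformN -/(qform _ _); lra.
apply: loewner_leP => [||x]; rewrite ?trmx0 //; first exact: block_sym.
rewrite -(vsubmxK x); move: (usubmx x) (dsubmx x) => u v.
have := loewner_qform u h; rewrite qform_block cross !qform0 qformD QWQ qformN.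
have := qform1_ge0 (S *m Q *m u + (- 1) *: v).
rewrite qform_cross ?tr_scalar_mx // qformZr -scalemxAr [X in X *+ 2]mxE; lra.
Qed.

End SchurComplement.

Section SemidefiniteProgram.
Context {R : realType} (N M : nat) (n : 'I_N -> nat) (q : 'I_N -> 'I_M -> nat)
  (A W T : forall i : 'I_N, 'M[R]_(n i))
  (C : forall (i : 'I_N) (j : 'I_M), 'M[R]_(q i j, n i))
  (V : forall (i : 'I_N) (j : 'I_M), 'M[R]_(q i j))
  (kappa : 'I_N -> 'I_M -> R).
Context (W_psd : forall i, psdmx (W i)) (T_psd : forall i, psdmx (T i))
  (V_pd : forall i j, pdmx (V i j)).

Let lmi (Q : forall i, 'M[R]_(n i)) (p : 'I_N -> 'I_M -> R) i :=
  Q i *m A i + (A i)^T *m Q i - \sum_(j < M) p i j *: info_mx (C i j) (V i j).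

Let lmi_sym Q p i : (Q i)^T = Q i -> (lmi Q p i)^T = lmi Q p i.
Proof.
move=> sQ; rewrite linearB linearD /= !trmx_mul trmxK sQ; congr (_ - _).
  by rewrite addrC.
rewrite linear_sum; apply: eq_bigr => j _.
by rewrite linearZ /= (psd_sym (info_mx_psd C V_pd i j)).
Qed.

Let riccatiE Q p i : Q i *m A i + (A i)^T *m Q i + Q i *m W i *m Q i
    - \sum_(j < M) p i j *: info_mx (C i j) (V i j) = lmi Q p i + Q i *m W i *m Q i.
Proof. by rewrite addrAC. Qed.

(** From the semidefinite program, replacing [S i] by [invmx (Q i)] can only lower the cost. In the
    other direction the strict block inequality rules out [S i = invmx (Q i)] itself in positive
    dimension, so the values are compared up to an arbitrary [e]. *)
Lemma sdp_value_eq_riccati_value :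
  sdp_value A W T C V kappa = riccati_value A W T C V kappa.
Proof.
apply/eqP; rewrite eq_le; apply/andP; split.
- apply: le_ereal_inf_tmp => _ [Q [p [[QP pc] ->]]].
  have Qp i : pdmx (Q i) by case: (QP i) => _; rewrite loewner_lt0.
  apply/lee_addgt0Pr => e e0; pose t := \sum_i `|\tr (T i)|.
  have t0 : 0 < t + 1 by rewrite ltr_wpDl // sumr_ge0.
  (* The shift by [d] raises the cost by [d] times the sum of the traces, hence by at most
     [d * t <= e]. *)
  pose d := e / (t + 1); have d0 : 0 < d by rewrite divr_gt0.
  pose S i := invmx (Q i) + d%:M.
  apply: (@le_trans _ _ (\sum_(i < N) (\tr (T i *m S i)
      + \sum_(j < M) kappa i j * p i j))%:E).
    apply: ereal_inf_lbound; exists S, Q, p; split => //; split => // i.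
    have sQ := pd_sym (Qp i).
    split.
    + by apply/symmetricmxP; rewrite linearD /= tr_scalar_mx invmx_sym.
    + exact/symmetricmxP.
    + by rewrite loewner_lt0; exact: inverse_block_pd.
    + apply/schur_nonpositive => //; first exact: lmi_sym.
      by case: (QP i); rewrite riccatiE.
  rewrite -EFinD lee_fin.
  have -> : \sum_(i < N) (\tr (T i *m S i) + \sum_(j < M) kappa i j * p i j) =
      \sum_(i < N) (\tr (T i *m invmx (Q i)) + \sum_(j < M) kappa i j * p i j)
      + d * \sum_i \tr (T i).
    rewrite mulr_sumr -big_split; apply: eq_bigr => i _ /=.
    by rewrite /S mulmxDr linearD /= mul_mx_scalar linearZ /=; ring.
  rewrite lerD2l; apply: (@le_trans _ _ (d * t)).
    by rewrite ler_wpM2l ?(ltW d0) // ler_sum // => i _; exact: ler_norm.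
  by rewrite /d mulrAC ler_pdivrMr // ler_pM2l // lerDl.
- apply: le_ereal_inf_tmp => _ [S [Q [p [[QP pc] ->]]]].
  have Qi i : [/\ (Q i)^T = Q i, pdmx (Q i) & invmx (Q i) ⪯ S i].
    case: (QP i) => /symmetricmxP sS /symmetricmxP sQ; rewrite loewner_lt0 => Bp _.
    by have [] := block_pd_inverse sQ Bp sS.
  apply: (@le_trans _ _ (\sum_(i < N) (\tr (T i *m invmx (Q i))
      + \sum_(j < M) kappa i j * p i j))%:E).
    apply: ereal_inf_lbound; exists Q, p; split => //; split => // i.
    have [sQ Qp _] := Qi i; split; last by rewrite loewner_lt0.
    rewrite riccatiE; apply/(schur_nonpositive (lmi_sym p sQ) sQ (W_psd i)).
    by case: (QP i).
  rewrite lee_fin; apply: ler_sum => i _; rewrite lerD2r.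
  by have [_ _ h] := Qi i; exact: loewner_tr.
Qed.

End SemidefiniteProgram.

Theorem mainTheorem2 (R : realType) (N M : nat)
    (n : 'I_N -> nat) (q : 'I_N -> 'I_M -> nat)
    (A W T : forall i : 'I_N, 'M[R]_(n i))
    (C : forall (i : 'I_N) (j : 'I_M), 'M[R]_(q i j, n i))
    (V : forall (i : 'I_N) (j : 'I_M), 'M[R]_(q i j))
    (kappa : 'I_N -> 'I_M -> R)
    (Sigma0 : forall i : 'I_N, 'M[R]_(n i))
    (W_psd : forall i, 0 ⪯ W i)
    (T_psd : forall i, 0 ⪯ T i)
    (V_pd : forall i j, 0 ≺ V i j)
    (Sigma0_pd : forall i, 0 ≺ Sigma0 i)
    (AC_detectable : forall i, exists (m : nat) (js : 'I_m -> 'I_M),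
       detectable (A i) (stacked_output C i js))
    (AW_controllable : forall i, controllable (A i) (sqrtmx (W i))) :
  (forall (pi : 'I_N -> 'I_M -> R -> bool)
          (Sigma : forall i : 'I_N, R -> 'M[R]_(n i)),
     admissible pi ->
     error_covariance A W C V Sigma0 pi Sigma ->
     (riccati_value A W T C V kappa <= average_cost T kappa pi Sigma)%E) /\
  sdp_value A W T C V kappa = riccati_value A W T C V kappa.
Proof.
have W0 i : psdmx (W i) by rewrite -loewner0.
have T0 i : psdmx (T i) by rewrite -loewner0.
have V0 i j : pdmx (V i j) by rewrite -loewner_lt0.
have S0 i : pdmx (Sigma0 i) by rewrite -loewner_lt0.
split; last exact: sdp_value_eq_riccati_value.
by move=> pi Sigma; exact: riccati_value_le_average_cost.
Qed.
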